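(* Let $R\ge 2$ be an even integer. Let $t_i=2i(R-1)$ for $i=0,1,\dots,R/2$, and let $\{S_j\}_{j\in J}$ be the iterated function system defined in the context. Then there exists a choice of probabilities $p_{t_0},p_{t_1},\dots,p_{t_{R/2}}$ and $p^*$ (admissible in the sense of the context) such that, for the associated self-similar measure $\mu$, the set of attainable local dimensions of $\mu$ is a disjoint union of an interval, namely the set of local dimensions of $\mu$ at points in the essential class, and $R/2$ singletons. Moreover, the singletons are of the form $\left\{\frac{\log p_{t_i}}{\log (1/R)}\right\}$ for $i=0,1,\dots,R/2$, with $p_{t_0}=p_{t_{R/2}}$ (so that $i=0$ and $i=R/2$ give the same singleton).
   Context: **Construction.** $R\ge2$ is an even integer. For $j\in\{0,1,\dots,R(R-1)\}$ let $S_j(x)=\frac{x}{R}+\frac{j}{R^2}$. For $i=0,\dots,R/2$ let $t_i=2i(R-1)$ and $K_i=\{2i/R\}$ (the fixed point of $S_{t_i}$); note $t_0=0$, $t_{R/2}=R(R-1)$. Let $I=\{\,j\in\{1,\dots,R(R-1)-1\}: S_j((0,1))\cap K_i=\emptyset \text{ for all } i=0,\dots,R/2\,\}$, $\mathcal A=\{S_j\}_{j\in I}$, $J=I\cup\{t_0,\dots,t_{R/2}\}$ (a disjoint union). The iterated function system (IFS) is $\{S_j\}_{j\in J}$; its attractor is $[0,1]$. **Probabilities.** Each $S_{t_i}$ is given a probability $p_{t_i}>0$, and every $S_j$ with $j\in I$ is given the same probability $p_j=p^*>0$, with $\sum_{j\in J}p_j=1$ and $p_0=p_{R(R-1)}=\min_{j\in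 J}p_j$; such choices are called admissible. $\mu$ is the unique Borel probability measure with $\mu=\sum_{j\in J}p_j\,\mu\circ S_j^{-1}$; its support is $[0,1]$. **Local dimension.** $\dim_{\mathrm{loc}}\mu(x)=\lim_{r\to0^+}\frac{\log\mu([x-r,x+r])}{\log r}$ when the limit exists. The set of attainable local dimensions is the set of all values $\dim_{\mathrm{loc}}\mu(x)$, over all $x\in\operatorname{supp}\mu=[0,1]$ at which the limit exists. An interval is allowed to be degenerate (a single point). **Essential class.** Put $r=1/R$ and $S_\sigma=S_{\sigma_1}\circ\dots\circ S_{\sigma_n}$ for $\sigma\in\Lambda_n=J^n$. List the elements of $\{S_\sigma(0),S_\sigma(1):\sigma\in\Lambda_n\}$ in increasing order as $h_1<\dots<h_{s_n}$; the intervals $[h_j,h_{j+1}]$ are the net intervals of generation $n$ (for $n=0$ the only net interval is $[0,1]$). Each net interval $\Delta$ of generation $n\ge1$ is contained in a unique net interval $\widehat\Delta$ of generation $n-1$; $\Delta$ is a child of its parent $\widehat\Delta$. For a net interval $\Delta=[a,b]$ of generation $n$, its normalized length is $\ell_n(\Delta)=r^{-n}(b-a)$, and its neighbour set $V_n(\Delta)$ is the tuple, in increasing order, of the distinct numbers $r^{-n}(a-S_\sigma(0))$ with $\sigma\in\Lambda_n$, $\Delta\subseteq S_\sigma([0,1])$. The reduced characteristic vector of $\Delta$ is $(\ell_n(\Delta),V_n(\Delta))$. The reduced characteristic vectors of the children of $\Delta$ depend only on that of $\Delta$, so one may speak of children of a reduced characteristic vector. The set $\Omega$ of all reduced characteristic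 vectors is finite here. A non-empty $\Omega'\subseteq\Omega$ is a loop class if for all $\alpha,\beta\in\Omega'$ there is a path $\alpha=\gamma_1,\dots,\gamma_n=\beta$ in $\Omega'$ with each $\gamma_{j+1}$ a child of $\gamma_j$; it is an essential class if moreover every child of every element of $\Omega'$ is in $\Omega'$. There is a unique essential class $\Omega_0$. A symbolic representation of $x\in[0,1]$ is the sequence of (reduced) characteristic vectors of net intervals $\Delta_0\supset\Delta_1\supset\cdots$, with $\Delta_n$ of generation $n$, $\Delta_{n-1}$ the parent of $\Delta_n$ and $x\in\Delta_n$ for all $n$ (a point that is an endpoint of net intervals can have two). The point $x$ is in the essential class if it has a symbolic representation whose terms lie in $\Omega_0$ for all large $n$. *)

(* Defs.v *)
From HB Require Import structures.
From mathcomp Require Import all_boot all_order all_algebra.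
From mathcomp Require Import all_classical all_reals all_analysis.
Import Order.TTheory GRing.Theory Num.Theory.
Import numFieldNormedType.Exports.

Set Implicit Arguments.
Unset Strict Implicit.
Unset Printing Implicit Defensive.

Local Open Scope classical_set_scope.
Local Open Scope ring_scope.

Section IFS.
Context {K : realType}.
Variable R : nat.

Definition Smap (j : nat) (x : K) : K := x / R%:R + j%:R / R%:R ^+ 2.

Definition tidx (i : nat) : nat := (2 * i * (R - 1))%N.

(* The single point of K_i, i.e. the fixed point of Smap (tidx i). *)
Definition fixpt (i : nat) : K := (2 * i)%:R / R%:R.

Definition inI (j : nat) : bool :=
  (1 <= j <= R * (R - 1) - 1)%N &&
  `[< forall i, (i <= R./2)%N -> Smap j @` `]0, 1[ `&` [set fixpt i] = set0 >].

Definition inJ (j : nat) : bool :=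
  inI j || `[< exists2 i, (i <= R./2)%N & j = tidx i >].

(* Only the values of p at indices in J matter. *)
Record admissible (p : nat -> K) (pstar : K) : Prop := Admissible {
  adm_t_gt0 : forall i, (i <= R./2)%N -> 0 < p (tidx i);
  adm_star_gt0 : 0 < pstar;
  adm_star : forall j, inI j -> p j = pstar;
  adm_sum1 : \sum_(0 <= j < (R * (R - 1)).+1 | inJ j) p j = 1;
  adm_ends : p 0%N = p (R * (R - 1))%N;
  adm_min : forall j, inJ j -> p 0%N <= p j
}.

Definition self_similar (p : nat -> K) (mu : set K -> \bar K) : Prop :=
  forall A : set (measurableTypeR K), measurable A ->
    mu A = (\sum_(0 <= j < (R * (R - 1)).+1 | inJ j)
              (p j)%:E * mu (Smap j @^-1` A))%E.

Definition Sword (s : seq nat) (x : K) : K := foldr Smap x s.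

Definition Lambda (n : nat) : set (seq nat) :=
  [set s | size s = n /\ all inJ s].

Definition endpts (n : nat) : set K :=
  [set x | exists2 s, Lambda n s & x = Sword s 0 \/ x = Sword s 1].

(* A pair (a, b) stands for the interval [a, b]. *)
Definition net_itv (D : K * K) : set K := `[D.1, D.2].

Definition net_interval (n : nat) (D : K * K) : Prop :=
  [/\ endpts n D.1, endpts n D.2, D.1 < D.2 &
      forall x, endpts n x -> ~ (D.1 < x < D.2)].

Definition norm_length (n : nat) (D : K * K) : K := R%:R ^+ n * (D.2 - D.1).

(* An increasing tuple of distinct reals is encoded by the set of its
   entries. *)
Definition neighbour_set (n : nat) (D : K * K) : set K :=
  [set v | exists2 s, Lambda n s /\ net_itv D `<=` Sword s @` `[0, 1] &
           v = R%:R ^+ n * (D.1 - Sword s 0)].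

Definition char_vec (n : nat) (D : K * K) : K * set K :=
  (norm_length n D, neighbour_set n D).

Definition Omega : set (K * set K) :=
  [set v | exists n D, net_interval n D /\ v = char_vec n D].

(* [child_interval n D' D]: D' is a child (of generation n.+1) of D. *)
Definition child_interval (n : nat) (D' D : K * K) : Prop :=
  [/\ net_interval n D, net_interval n.+1 D' & net_itv D' `<=` net_itv D].

Definition child (v' v : K * set K) : Prop :=
  exists n D' D, [/\ child_interval n D' D,
    v' = char_vec n.+1 D' & v = char_vec n D].

Definition loop_class (W : set (K * set K)) : Prop :=
  [/\ W !=set0, W `<=` Omega &
      forall a b, W a -> W b ->
        exists m (g : nat -> K * set K),
          [/\ g 0%N = a, g m = b, forall k, (k <= m)%N -> W (g k) &
              forall k, (k < m)%N -> child (g k.+1) (g k)]].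

Definition essential_class (W : set (K * set K)) : Prop :=
  loop_class W /\ forall v' v, W v -> child v' v -> W v'.

Definition in_essential_class (x : K) : Prop :=
  exists W, essential_class W /\
  exists D : nat -> K * K,
    [/\ net_interval 0 (D 0%N),
        forall n, child_interval n (D n.+1) (D n),
        forall n, net_itv (D n) x &
        exists n0, forall n, (n0 <= n)%N -> W (char_vec n (D n))].

End IFS.

(* Applied to all their arguments, these still do not determine K. *)
Arguments inI K R j : clear implicits.
Arguments inJ K R j : clear implicits.
Arguments Lambda K R n : clear implicits.

Section LocalDimension.
Context {K : realType}.
Variable mu : set K -> \bar K.

Definition supp : set K :=
  [set x | forall r, 0 < r -> (0 < mu `](x - r)%R, (x + r)%R[)%E].

Definition has_local_dim (x d : K) : Prop :=
  ln (fine (mu `[x - r, x + r])) / ln r @[r --> 0^'+] --> d.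

Definition local_dims (A : set K) : set K :=
  [set d | exists2 x, A x & has_local_dim x d].

End LocalDimension.

(* Main.v *)
(* Write every position in units of R^-(n+1): all net intervals of generation
   n >= 1 are [m, m+1] in these units, and the neighbours of such an interval
   are some of the numbers z/R, 0 <= z < R. As soon as both an even and an odd z
   occur, all children have all R neighbours; so the essential class is a single
   reduced characteristic vector, and a point is in it unless it is one of the
   fixed points 2i/R, where the neighbours on each side have the same parity.

   The masses of the net intervals with a given R-adic word w are governed by a
   product T_w of nonnegative R x R matrices. The word 10 has a positive matrix,
   so the sum of the entries of T_w is multiplicative up to bounded factors when
   10 is inserted between words. Given two words of equal length whose growth
   rates lie on either side of a prescribed one, a greedy concatenation stays
   within bounded factors of that rate: the essential dimensions form an
   interval. They are at most log p* / log (1/R), because all column sums of the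
   matrices are at least p* when p* = 2 p_0.

   At 2i/R the mass of a ball obeys a recursion with leading coefficient p_(t_i);
   the weights 2R on I, R + i at t_i and R at both ends make these
   probabilities distinct and smaller than p*. *)
Require Import Defs.
From mathcomp Require Import all_boot all_order all_algebra.
From mathcomp Require Import all_classical all_reals all_analysis.
From mathcomp Require Import measurable_realfun zify ring lra.
Import Order.TTheory GRing.Theory Num.Theory.
Import numFieldNormedType.Exports.
Local Open Scope classical_set_scope.
Local Open Scope ring_scope.

Set Implicit Arguments.
Unset Strict Implicit.
Unset Printing Implicit Defensive.

(** * The index set J *)

(** A single relation, [j + z' = R * z + c] with [j] in J, drives both halves of the proof. At the
    right end of a word it says how appending the digit [c] turns the neighbour z/R into z'/R; at
    the left end it says that [Smap j] pulls the net interval with digits z, c, w back to the one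
    with digits z', w. Hence the entry (v, z) of T_w is positive exactly when z/R is a neighbour of
    the net interval with digits v :: w, and parity arguments on neighbours also yield lower bounds
    on matrix entries. The obstacle is that the matrices have zero entries: the mass of a ball is
    comparable to the sum of the entries only after a prefix whose row is positive. The length of
    that prefix, and so the constants, depend on the distance from x to the points 2i/R. This is
    harmless for a local dimension at a fixed x, and it is why the points 2i/R need their own
    recursion. As log (1/R) is negative, p_(t_i) < p* puts the isolated dimensions strictly above
    all essential ones. *)

Section Indices.
Variables (K : realType) (R : nat).
Hypotheses (hR : (2 <= R)%N) (hRe : ~~ odd R).

Lemma half_double : R = (R./2 + R./2)%N.
Proof. by rewrite addnn even_halfK. Qed.

Lemma R_gt0 : 0 < R%:R :> K. Proof. by rewrite ltr0n (leq_trans _ hR). Qed.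
Lemma R_neq0 : R%:R != 0 :> K. Proof. by rewrite gt_eqF ?R_gt0. Qed.
Lemma R_gt1 : 1 < R%:R :> K. Proof. by rewrite ltr1n. Qed.

(** In units of R^-2 the open image is (j, j + R) and the fixed point is 2iR. *)
Lemma Smap_open_fixpt (j i : nat) :
  (Smap R j @` `]0, 1[ `&` [set fixpt R i : K] = set0) <->
  ~ (j < 2 * i * R < j + R)%N.
Proof.
have R0 := R_gt0.
split.
- move=> E /andP[h1 h2].
  suff : (Smap R j @` `]0, 1[ `&` [set fixpt R i : K]) (fixpt R i) by rewrite E.
  split => //; exists (((2 * i * R)%:R - j%:R) / R%:R).
    rewrite /= in_itv /= divr_gt0 ?ltr_pdivrMr ?mul1r// ?subr_gt0 ?ltr_nat//.
    by rewrite ltrBlDl -natrD ltr_nat.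
  by rewrite /Smap /fixpt !natrM; field; rewrite R_neq0.
- move=> H; rewrite -subset0 => x [[y /=]]; rewrite in_itv /= => /andP[y0 y1].
  move=> <- /= E; apply: H.
  have {}E : (2 * i * R)%:R = j%:R + y * R%:R.
    apply: (mulfI (x := (R%:R ^+ 2)^-1)); first by rewrite invr_eq0 expf_neq0 ?R_neq0.
    move: E; rewrite /Smap /fixpt !natrM => E.
    transitivity (2 * i%:R / R%:R : K); first by field; rewrite R_neq0.
    by rewrite -E; field; rewrite R_neq0.
  rewrite -!(ltr_nat K) E natrD ltrDl ltrD2l mulr_gt0//=.
  by rewrite gtr_pMl.
Qed.

Lemma inIP j : reflect ((1 <= j <= R * (R - 1) - 1)%N /\
    forall i, (i <= R./2)%N -> ~ (j < 2 * i * R < j + R)%N) (inI K R j).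
Proof.
apply: (iffP andP) => -[h1 h2]; split => //.
  by move=> i hi; apply/Smap_open_fixpt; move/asboolP: h2; apply.
by apply/asboolP => i hi; apply/Smap_open_fixpt/h2.
Qed.

Lemma inJP j : reflect (inI K R j \/ exists2 i, (i <= R./2)%N & j = tidx R i)
  (inJ K R j).
Proof.
apply: (iffP orP) => -[]; try by left.
  by move=> /asboolP; right.
by right; apply/asboolP.
Qed.

Lemma inJ_tidx i : (i <= R./2)%N -> inJ K R (tidx R i).
Proof. by move=> hi; apply/inJP; right; exists i. Qed.

Lemma tidx0 : tidx R 0 = 0%N. Proof. by rewrite /tidx muln0. Qed.

Lemma tidx_half : tidx R R./2 = (R * (R - 1))%N.
Proof. by rewrite /tidx mul2n -addnn -half_double. Qed.

Lemma tidx_eq i : tidx R i = (2 * i * R - 2 * i)%N.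
Proof. by rewrite /tidx mulnBr muln1. Qed.

Lemma inJ_le j : inJ K R j -> (j <= R * (R - 1))%N.
Proof.
move=> /inJP[/inIP[/andP[_ h] _]|[i hi ->]]; first by exact: leq_trans h (leq_subr _ _).
by rewrite /tidx leq_mul2r; have := half_double; move: hi; lia.
Qed.

(** In units of R^-2 the fixed points are the multiples of 2R and the images have length R, so the
    images that fit between two consecutive fixed points have the indices 2qR, ..., 2qR + R. The two
    excluded values are t_0 and t_(R/2), the outer ends of the first and the last block. *)
Lemma block_inI q s : (2 * q < R)%N -> (s <= R)%N ->
  let j := (2 * q * R + s)%N in j != 0%N -> j != (R * (R - 1))%N -> inI K R j.
Proof.
move=> hq hs j j0 j1; have hh := half_double.
have hq' : (q < R./2)%N by lia.
have hqR : (2 * q * R + 2 * R <= R * R)%N.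
  by rewrite -mulnDl leq_mul2r; apply/orP; right; lia.
apply/inIP; split.
  by move: j0 j1; rewrite /j mulnBr muln1; lia.
move=> i hi /andP[]; rewrite /j.
have [iq|qi] := leqP i q.
  by have : (2 * i * R <= 2 * q * R)%N; [rewrite leq_mul2r; lia|lia].
have : (2 * q.+1 * R <= 2 * i * R)%N; first by rewrite leq_mul2r; lia.
rewrite mulnS mulnDl; lia.
Qed.

Lemma block_inJ q s : (2 * q < R)%N -> (s <= R)%N -> inJ K R (2 * q * R + s).
Proof.
move=> hq hs.
have [->|j0] := eqVneq (2 * q * R + s)%N 0%N; first by rewrite -tidx0 inJ_tidx.
have [->|j1] := eqVneq (2 * q * R + s)%N (R * (R - 1))%N.
  by rewrite -tidx_half inJ_tidx.
by apply/inJP; left; apply: block_inI.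
Qed.

Lemma inI_block j : inI K R j ->
  exists q s, [/\ j = (2 * q * R + s)%N, (s <= R)%N & (2 * q < R)%N].
Proof.
move=> /inIP[/andP[h1 h2] H]; have hh := half_double.
have E := divn_eq j (2 * R); set q := (j %/ _)%N in E; set s := (j %% _)%N in E.
have hs : (s < 2 * R)%N by rewrite ltn_mod; lia.
have hq : (2 * q < R)%N.
  have : (2 * q * R < R * R)%N.
    have : (R * (R - 1) < R * R)%N by rewrite ltn_mul2l; lia.
    lia.
  by rewrite ltn_mul2r; lia.
exists q, s; split => //; first by rewrite E; lia.
rewrite leqNgt; apply/negP => hRs.
apply: (H q.+1); first by lia.
by rewrite E; lia.
Qed.

Lemma even_tidx i : ~~ odd (tidx R i).
Proof. by rewrite /tidx -mulnA oddM. Qed.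

Lemma inJ_odd j : inJ K R j -> odd j ->
  exists q s, [/\ j = (2 * q * R + s)%N, (s <= R)%N & (2 * q < R)%N].
Proof.
move=> /inJP[/inI_block//|[i _ ->]]; by rewrite (negbTE (even_tidx i)).
Qed.

(** For even [z] a block starts at [R * z], so letters slightly above [R * z] are available and
    every [z' <= c] is reached. For odd [z] ([odd_step]) a block ends there, and every [z' >= c] is
    reached. *)
Lemma even_step z c z' : ~~ odd z -> (z < R)%N -> (z' <= c)%N -> (c < R)%N ->
  exists2 j, inJ K R j & (j + z' = R * z + c)%N.
Proof.
move=> oz hz hc hcR; exists (R * z + (c - z'))%N; last by lia.
have -> : (R * z = 2 * z./2 * R)%N by rewrite mul2n even_halfK // mulnC.
by apply: block_inJ; [rewrite mul2n even_halfK|lia].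
Qed.

Lemma odd_step z c z' : odd z -> (z < R)%N -> (c <= z' < R)%N ->
  exists2 j, inJ K R j & (j + z' = R * z + c)%N.
Proof.
move=> oz hz /andP[hc hcR]; exists (2 * z./2 * R + (R - (z' - c)))%N.
  by apply: block_inJ; [rewrite mul2n; have := odd_double_half z; lia|lia].
have {2}-> : z = (2 * z./2).+1 by rewrite mul2n; have := odd_double_half z; lia.
by rewrite mulnS (mulnC R); lia.
Qed.

(** This letter leads from any state [z] to [z' = c], so the last digit of a net interval is always
    one of its neighbours. *)
Lemma mulR_inJ z : (z < R)%N -> inJ K R (R * z).
Proof.
move=> hz; have R0 : (0 < R)%N by lia.
have [oz|oz] := boolP (odd z).
  by have [j hj] := odd_step (c := 0) (z' := 0) oz hz R0; rewrite !addn0 => <-.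
by have [j hj] := even_step oz hz (leqnn 0) R0; rewrite !addn0 => <-.
Qed.

(* Only these images meet every neighbourhood of [2i/R]; the last two have it as
   an end point. *)
Lemma inJ_near_fixpt i j : (i <= R./2)%N -> inJ K R j ->
  (2 * i * R <= j + R)%N -> (j <= 2 * i * R)%N ->
  j = tidx R i \/ [/\ (0 < i)%N, (i < R./2)%N &
     j = (2 * i * R)%N \/ (j + R = 2 * i * R)%N].
Proof.
move=> hi hj h1 h2; have hh := half_double.
move/inJP: hj => [/inIP[/andP[j1 j2] H]|[i' hi' E]].
  right; have hj : j = (2 * i * R)%N \/ (j + R = 2 * i * R)%N.
    have := H _ hi; lia.
  have i0 : (0 < i)%N by rewrite lt0n; apply/eqP => i0; move: h2; rewrite i0; lia.
  split => //; rewrite ltn_neqAle hi andbT; apply/eqP => ih.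
  have : (2 * i * R = R * R)%N by rewrite ih mul2n -addnn -hh.
  by move: j2; rewrite mulnBr muln1; lia.
left; rewrite E; congr tidx; move: h1 h2; rewrite E /tidx.
have [ii h1 _|ii _ h2|//] := ltngtP i' i; exfalso.
  case: i ii hi h1 => // i ii hi h1.
  have : (2 * i' * (R - 1) <= 2 * i * (R - 1))%N by rewrite leq_mul2r; lia.
  have : (2 * i.+1 * R = 2 * i * (R - 1) + 2 * i + 2 * R)%N by nia.
  lia.
have : (2 * i.+1 * (R - 1) <= 2 * i' * (R - 1))%N by rewrite leq_mul2r; lia.
have : (2 * i.+1 * (R - 1) + 2 * i + 2 = 2 * i * R + 2 * R)%N by nia.
lia.
Qed.

End Indices.

(** * Words and neighbours *)

Section Words.
Variables (K : realType) (R : nat).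
Hypotheses (hR : (2 <= R)%N) (hRe : ~~ odd R).

(** Value in base R, used for two kinds of words: for letters of J, which may exceed R, it is the
    left end of the image in units of R^-(n+1); for R-adic digits it is the usual integer. *)
Fixpoint code (s : seq nat) : nat :=
  if s is j :: s' then (j * R ^ size s' + code s')%N else 0%N.

Lemma code_cat s t : code (s ++ t) = (code s * R ^ size t + code t)%N.
Proof.
by elim: s => [//|j s IH] /=; rewrite IH size_cat expnD mulnDl !mulnA addnA.
Qed.

Lemma code_rcons s j : code (rcons s j) = (R * code s + j)%N.
Proof. by rewrite -cats1 code_cat /= expn1 expn0 muln1 addn0 mulnC. Qed.

Definition digits (w : seq nat) := all (fun c => (c < R)%N) w.

Lemma code_lt w : digits w -> (code w < R ^ size w)%N.
Proof.
elim: w => [|c w IH] //= /andP[hc /IH h]; rewrite expnS.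
by have : (c.+1 * R ^ size w <= R * R ^ size w)%N; [rewrite leq_mul2r hc orbT|lia].
Qed.

Lemma code_surj n m : (m < R ^ n)%N ->
  exists w, [/\ size w = n, digits w & code w = m].
Proof.
elim: n m => [|n IH] m hm.
  by exists [::]; split => //=; move: hm; rewrite expn0; lia.
have R0 : (0 < R)%N by lia.
have [|w [sw dw cw]] := IH (m %/ R)%N.
  by rewrite ltn_divLR // mulnC -expnS.
exists (rcons w (m %% R)%N); split; first by rewrite size_rcons sw.
  by rewrite /digits all_rcons /= ltn_mod R0.
by rewrite code_rcons cw mulnC -divn_eq.
Qed.

(* Think of [P w z] as: the net interval with digits [v :: w] has the neighbour
   [z/R]; the abstraction also covers lower bounds on transfer matrix entries. *)
Section Parity.
Variables (v : nat) (P : seq nat -> nat -> Prop).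
Hypotheses (hv : (v < R)%N) (P0 : P [::] v).
Hypothesis PS : forall w z c j z', digits w -> P w z -> (z < R)%N ->
  (c < R)%N -> (z' < R)%N -> inJ K R j -> (j + z' = R * z + c)%N ->
  P (rcons w c) z'.

Definition both_parities w :=
  (exists z, [/\ (z < R)%N, ~~ odd z & P w z]) /\
  (exists z, [/\ (z < R)%N, odd z & P w z]).

Lemma even_child w z c z' : digits w -> (c < R)%N -> (z < R)%N -> ~~ odd z ->
  P w z -> (z' <= c)%N -> P (rcons w c) z'.
Proof.
move=> dw hc hz oz Pz hz'; have [j jJ E] := even_step K hR hRe oz hz hz' hc.
by apply: PS jJ E => //; lia.
Qed.

Lemma odd_child w z c z' : digits w -> (z < R)%N -> odd z ->
  P w z -> (c <= z' < R)%N -> P (rcons w c) z'.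
Proof.
move=> dw hz oz Pz hz'; have [j jJ E] := odd_step K hR hRe oz hz hz'.
by apply: PS jJ E => //; lia.
Qed.

(** The even neighbour covers the values up to [c], the odd one those from [c] on. *)
Lemma both_full w c z : digits w -> (c < R)%N -> (z < R)%N ->
  both_parities w -> P (rcons w c) z.
Proof.
move=> dw hc hz [[z1 [h1 o1 P1]] [z2 [h2 o2 P2]]].
have [zc|cz] := leqP z c; first exact: even_child P1 zc.
by apply: odd_child P2 _ => //; lia.
Qed.

Lemma both_rcons w c : digits w -> (c < R)%N ->
  both_parities w -> both_parities (rcons w c).
Proof.
move=> dw hc bw; split; [exists 0%N|exists 1%N]; split => //; try lia.
- by apply: both_full => //; lia.
- by apply: both_full.
Qed.

(** The digit 0 preserves an even neighbour; the first nonzero digit sends it to both 0 and 1, and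
    afterwards both parities persist. *)
Lemma even_parity w : ~~ odd v -> digits w ->
  (code w = 0%N -> exists z, [/\ (z < R)%N, ~~ odd z & P w z]) /\
  ((0 < code w)%N -> both_parities w).
Proof.
move=> ov; elim/last_ind: w => [_|w c IH]; first by split => // _; exists v.
rewrite /digits all_rcons => /andP[hc dw]; have [IH0 IH1] := IH dw.
rewrite code_rcons; split.
  move=> E; have /IH0 [z [hz oz Pz]] : code w = 0%N by nia.
  by exists 0%N; split => //; [lia|apply: even_child Pz _].
have [cw|cw _] := posnP (code w); last by apply: both_rcons => //; apply: IH1.
rewrite cw muln0 => c0; have [z [hz oz Pz]] := IH0 cw.
by split; [exists 0%N|exists 1%N]; split => //; try lia; apply: even_child Pz _.
Qed.

(** Mirror image of [even_parity]: the digit R - 1 preserves an odd neighbour, and the first smaller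
    digit sends it to both R - 2 and R - 1. *)
Lemma odd_parity w : odd v -> digits w ->
  ((code w).+1 = R ^ size w -> exists z, [/\ (z < R)%N, odd z & P w z])%N /\
  (((code w).+1 < R ^ size w)%N -> both_parities w).
Proof.
move=> ov; elim/last_ind: w => [_|w c IH]; first by split => // _; exists v.
rewrite /digits all_rcons => /andP[hc dw]; have [IH0 IH1] := IH dw.
have oR1 : odd (R - 1) by rewrite oddB ?(negbTE hRe) //; lia.
have eR2 : ~~ odd (R - 2) by rewrite oddB ?(negbTE hRe) //; lia.
have := code_lt dw; rewrite code_rcons size_rcons expnS => cw.
have [cw'|cw'] := ltnP (code w).+1 (R ^ size w).
  have : (R * (code w).+2 <= R * R ^ size w)%N by rewrite leq_mul2l cw' orbT.
  rewrite !mulnS => h; split => [|_]; first by lia.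
  by apply: both_rcons => //; apply: IH1.
have cE : ((code w).+1 = R ^ size w)%N by lia.
have [z [hz oz Pz]] := IH0 cE.
rewrite -cE mulnS; split => h.
  exists (R - 1)%N; split; [lia|done|].
  by apply: odd_child Pz _ => //; lia.
by split; [exists (R - 2)%N|exists (R - 1)%N]; split => //; try lia;
  apply: odd_child Pz _ => //; lia.
Qed.

Lemma parity_full w c z : digits w -> (c < R)%N -> (z < R)%N ->
  (~~ odd v -> (0 < code w)%N) ->
  (odd v -> ((code w).+1 < R ^ size w)%N) -> P (rcons w c) z.
Proof.
move=> dw hc hz he ho; apply: both_full => //.
have [ov|ov] := boolP (odd v); first exact: (odd_parity ov dw).2 (ho ov).
exact: (even_parity ov dw).2 (he ov).
Qed.
End Parity.

(* [z] stands for the neighbour [z/R] of the net interval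
   [m/R^(n+1), (m+1)/R^(n+1)]. *)
Definition neighbour (n m z : nat) : Prop :=
  exists2 s, Lambda K R n s & (code s + z = m)%N.

Lemma neighbour_child n m z j c z' : neighbour n m z -> inJ K R j ->
  (j + z' = R * z + c)%N -> neighbour n.+1 (R * m + c) z'.
Proof.
move=> [s [sn sJ] <-] hj E; exists (rcons s j).
  by split; [rewrite size_rcons sn|rewrite all_rcons hj].
by rewrite code_rcons mulnDr -!addnA E.
Qed.

Lemma neighbour_mod n m : (m < R ^ n.+1)%N -> neighbour n m (m %% R).
Proof.
have R0 : (0 < R)%N by lia.
elim: n m => [|n IH] m hm.
  by exists [::] => //=; rewrite modn_small // -(expn1 R).
rewrite {1}(divn_eq m R) mulnC.
have hm' : (m %/ R < R ^ n.+1)%N by rewrite ltn_divLR // mulnC -expnS.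
have hz : ((m %/ R) %% R < R)%N by rewrite ltn_mod.
exact: neighbour_child (IH _ hm') (mulR_inJ K hR hRe hz) _.
Qed.

Lemma neighbour_full_child n m c z : (forall z, (z < R)%N -> neighbour n m z) ->
  (c < R)%N -> (z < R)%N -> neighbour n.+1 (R * m + c) z.
Proof.
move=> H hc hz; have [zc|cz] := leqP z c.
  have [|j jJ E] := even_step K hR hRe (isT : ~~ odd 0) _ zc hc; first by lia.
  by apply: neighbour_child (H 0%N _) jJ E; lia.
have [||j jJ E] := odd_step K hR hRe (isT : odd 1) (c := c) (z' := z); [lia|lia|].
by apply: neighbour_child (H 1%N _) jJ E; lia.
Qed.

(** After the digit 1 the neighbour 1 is present; being odd, it reaches every [z >= 0] through the
    digit 0. *)
Lemma neighbour_10 n m z : (m < R ^ n.+1)%N -> (z < R)%N ->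
  neighbour n.+2 (R * (R * m + 1) + 0) z.
Proof.
move=> hm hz; have R0 : (0 < R)%N by lia.
have h1 : neighbour n.+1 (R * m + 1) 1.
  have hz' : (m %% R < R)%N by rewrite ltn_mod.
  exact: neighbour_child (neighbour_mod hm) (mulR_inJ K hR hRe hz') _.
have [||j jJ E] := odd_step K hR hRe (isT : odd 1) (c := 0) (z' := z); [lia|lia|].
exact: neighbour_child h1 jJ E.
Qed.

(* Excludes the neighbours of the wrong parity on either side of [2i/R]. *)
Lemma code_near_fixpt i s : all (inJ K R) s -> odd (code s) ->
  ~ (2 * i * R ^ size s < code s + R /\ code s < 2 * i * R ^ size s)%N.
Proof.
elim/last_ind: s => [//|s j IH]; rewrite all_rcons => /andP[hj hs].
rewrite code_rcons size_rcons expnS oddD oddM (negbTE hRe) /= => oj [h1 h2].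
have [q [t [jE tR qR]]] := inJ_odd hR hRe hj oj.
have ot : odd t by move: oj; rewrite jE oddD oddM (negbTE hRe) andbF.
have tR' : (t < R)%N.
  by rewrite ltn_neqAle tR andbT; apply: contraNneq hRe => <-.
have h3 : (2 * i * (R * R ^ size s) = R * (2 * i * R ^ size s))%N by lia.
have t0 : (0 < t)%N by case: (t) ot.
set M := (2 * i * R ^ size s)%N in h3.
(* Descent: the last letter is odd, hence no [tidx], and its offset [t] in its block is strictly
   between 0 and R. This equation then puts the shorter word, again of odd code, in the same window
   below [M]. *)
have E : (code s + 2 * q + 1 = M)%N by nia.
have oc : odd (code s).
  have : odd (code s + 2 * q + 1) = false.
    by rewrite E /M -mulnA oddM.
  by rewrite addn1 /= oddD oddM /= addbF => /negbFE.
by apply: (IH hs oc); rewrite -/M; lia.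
Qed.

(** The neighbour 1 on the right of 2i/R, or the neighbour 0 on its left, would come from a word
    whose code is the odd number just below [2 * i * R ^ n]. *)
Lemma not_full_near_fixpt i n m :
  m = (2 * i * R ^ n)%N \/ m.+1 = (2 * i * R ^ n)%N ->
  ~ (forall z, (z < R)%N -> neighbour n m z).
Proof.
move=> hm H.
suff [s [sn sJ] E] : exists2 s, Lambda K R n s & ((code s).+1 = 2 * i * R ^ n)%N.
  apply: (@code_near_fixpt i s) => //; last by rewrite sn; lia.
  by have : odd (code s).+1 = false; [rewrite E -mulnA oddM|move=> /negbFE].
case: hm => hm.
  by have [|s sL E] := H 1%N; [lia|exists s; rewrite // -hm -E addn1].
by have [|s sL E] := H 0%N; [lia|exists s; rewrite // -hm -E addn0].
Qed.

End Words.

(** * Net intervals and the essential class *)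

Section Essential.
Variables (K : realType) (R : nat).
Hypotheses (hR : (2 <= R)%N) (hRe : ~~ odd R).
Local Notation B := (R%:R : K).

Let B0 : 0 < B := R_gt0 K hR.
Let Bn0 n : 0 < B ^+ n. Proof. exact: exprn_gt0. Qed.

Lemma Sword_code s (x : K) :
  Sword R s x = ((code R s)%:R + B * x) / B ^+ (size s).+1.
Proof.
elim: s => [|j s IH] /=; first by rewrite add0r expr1 mulrAC divff ?mul1r ?gt_eqF.
rewrite IH /Smap natrD natrM natrX !exprS; field.
by rewrite expf_neq0 ?gt_eqF.
Qed.

Definition gridpt n m : K := m%:R / B ^+ n.+1.

Lemma gridpt_le n a b : (gridpt n a <= gridpt n b) = (a <= b)%N.
Proof. by rewrite /gridpt ler_pM2r ?invr_gt0 // ler_nat. Qed.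

Lemma gridpt_lt n a b : (gridpt n a < gridpt n b) = (a < b)%N.
Proof. by rewrite /gridpt ltr_pM2r ?invr_gt0 // ltr_nat. Qed.

Lemma Sword0 s : Sword R s 0 = gridpt (size s) (code R s).
Proof. by rewrite Sword_code mulr0 addr0. Qed.

Lemma Sword1 s : Sword R s 1 = gridpt (size s) (code R s + R).
Proof. by rewrite Sword_code mulr1 -natrD. Qed.

(** Every multiple of R^-(n+2) in [0, 1] is thus an end point, so the net intervals of positive
    generation form the whole R-adic grid. With one letter, the parity of the leading digit decides
    whether [m] is a left or a right end. *)
Lemma code_cover n m : (m <= R ^ n.+2)%N ->
  exists2 s, Lambda K R n.+1 s & code R s = m \/ (code R s + R = m)%N.
Proof.
elim: n m => [|n IH] m hm.
  have one j : inJ K R j -> Lambda K R 1 [:: j] by move=> h; split => //=; rewrite h.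
  have [mE|hm'] := eqVneq m (R ^ 2)%N.
    exists [:: (R * (R - 1))%N].
      by apply: one; apply: mulR_inJ => //; lia.
    by right; rewrite mE /=; nia.
  have {hm hm'} hm : (m < R * R)%N by rewrite ltn_neqAle hm'.
  have R0 : (0 < R)%N by lia.
  have hv : (m %/ R < R)%N by rewrite ltn_divLR.
  have hs : (m %% R < R)%N by rewrite ltn_mod.
  have mE := divn_eq m R.
  have [ov|ov] := boolP (odd (m %/ R)).
    have vE := odd_double_half (m %/ R); rewrite ov in vE.
    exists [:: (2 * (m %/ R)./2 * R + m %% R)%N].
      by apply: one; apply: block_inJ => //; lia.
    by right; rewrite /= expn0 muln1; nia.
  have vE := odd_double_half (m %/ R); rewrite (negbTE ov) in vE.
  exists [:: (2 * (m %/ R)./2 * R + m %% R)%N].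
    by apply: one; apply: block_inJ => //; lia.
  by left; rewrite /= expn0 muln1; nia.
have R0 : (0 < R ^ n.+2)%N by rewrite expn_gt0; lia.
(* The cap takes effect only at the right end point 1, where the quotient is R. *)
pose v := minn (m %/ R ^ n.+2) (R - 1).
have hv : (v < R)%N by rewrite /v; lia.
have h1 : (v * R ^ n.+2 <= m)%N.
  by rewrite (leq_trans _ (leq_trunc_div m (R ^ n.+2))) // leq_mul2r geq_minl orbT.
have h2 : (m <= v * R ^ n.+2 + R ^ n.+2)%N.
  rewrite /v; have [h|h] := leqP (m %/ R ^ n.+2) (R - 1).
    by have := divn_eq m (R ^ n.+2); have := ltn_mod m (R ^ n.+2); lia.
  by move: hm; rewrite expnS; set X := (R ^ n.+2)%N; nia.
have [|s [sn sJ] sE] := IH (m - v * R ^ n.+2)%N; first by lia.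
exists (R * v :: s)%N.
  by split; [rewrite /= sn|rewrite /= sJ andbT; apply: mulR_inJ].
have E : (code R (R * v :: s) = v * R ^ n.+2 + code R s)%N.
  by rewrite /= sn (expnS R n.+1); lia.
by rewrite E; case: sE => sE; [left|right]; lia.
Qed.

Lemma code_bound s : all (inJ K R) s -> (code R s + R <= R ^ (size s).+1)%N.
Proof.
elim: s => [|j s IH] /=; first by rewrite expn1.
move=> /andP[/(inJ_le hR hRe) hj /IH {IH}]; rewrite !expnS.
set X := (R ^ size s)%N => h.
have : (j * X <= R * (R - 1) * X)%N by rewrite leq_mul2r hj orbT.
have : (R * (R * X) = R * (R - 1) * X + R * X)%N by nia.
lia.
Qed.

Lemma endptsP n (x : K) : endpts R n.+1 x <->
  exists2 m, (m <= R ^ n.+2)%N & x = gridpt n.+1 m.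
Proof.
split.
  move=> [s [sn sJ] []] ->.
    exists (code R s); last by rewrite Sword0 sn.
    by have := code_bound sJ; rewrite sn; lia.
  exists (code R s + R)%N; last by rewrite Sword1 sn.
  by have := code_bound sJ; rewrite sn.
move=> [m /code_cover[s [sn sJ] sE] ->]; exists s => //.
rewrite Sword0 Sword1 sn.
by case: sE => <-; [left|right].
Qed.

Definition cell n m : K * K := (gridpt n m, gridpt n m.+1).

Lemma net_intervalP n D : net_interval R n.+1 D <->
  exists2 m, (m < R ^ n.+2)%N & D = cell n.+1 m.
Proof.
split.
  case: D => a b [] /= /endptsP[m hm ->] /endptsP[m' hm' ->].
  rewrite gridpt_lt => mm H; exists m; first exact: leq_trans mm hm'.
  rewrite /cell; congr (_, gridpt _ _); apply/eqP; rewrite eqn_leq mm andbT.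
  rewrite leqNgt; apply/negP => h; apply: (H (gridpt n.+1 m.+1)).
    by apply/endptsP; exists m.+1 => //; lia.
  by rewrite !gridpt_lt ltnSn.
move=> [m hm ->]; split => /=.
- by apply/endptsP; exists m => //; exact: ltnW.
- by apply/endptsP; exists m.+1.
- by rewrite gridpt_lt.
- by move=> x /endptsP[m' _ ->]; rewrite !gridpt_lt => /andP[]; lia.
Qed.

Lemma endpts0 (x : K) : endpts R 0 x <-> x = 0 \/ x = 1.
Proof.
split; first by move=> [s [/size0nil -> _]].
by move=> H; exists [::].
Qed.

Lemma net_interval0 D : net_interval R 0 D <-> D = (0 : K, 1 : K).
Proof.
split.
  case: D => a b [] /= /endpts0 ha /endpts0 hb ab _.
  by case: ha hb ab => -> [] ->; rewrite ?ltxx ?ltr10.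
move=> ->; split => /=; rewrite ?ltr01 //.
- by apply/endpts0; left.
- by apply/endpts0; right.
- by move=> x /endpts0[] ->; rewrite ?ltxx ?andbF.
Qed.

Lemma Sword_image s (n m : nat) : size s = n ->
  net_itv (cell n m) `<=` Sword R s @` `[(0 : K), 1] <->
  (code R s <= m < code R s + R)%N.
Proof.
move=> sn; split.
  move=> H.
  have h1 : net_itv (cell n m) (gridpt n m).
    by rewrite /net_itv /= in_itv /= lexx gridpt_le leqnSn.
  have h2 : net_itv (cell n m) (gridpt n m.+1).
    by rewrite /net_itv /= in_itv /= lexx gridpt_le leqnSn.
  have [x] := H _ h1; have [y] := H _ h2.
  rewrite /= !in_itv /= => /andP[y0 y1] + /andP[x0 x1].
  rewrite !Sword_code sn /gridpt => /(mulIf (invr_neq0 (lt0r_neq0 (Bn0 _)))) Ey.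
  move=> /(mulIf (invr_neq0 (lt0r_neq0 (Bn0 _)))) Ex.
  apply/andP; split.
    by rewrite -(ler_nat K) -Ex lerDl mulr_ge0 // ltW.
  by rewrite -(ler_nat K) -Ey natrD lerD2l ger_pMr.
move=> /andP[h1 h2] x; rewrite /net_itv /= in_itv /= => /andP[x1 x2].
exists ((x * B ^+ n.+1 - (code R s)%:R) / B).
  rewrite /= in_itv /=; apply/andP; split.
    apply: divr_ge0; last exact: ltW.
    rewrite subr_ge0; apply: le_trans (_ : m%:R <= _); first by rewrite ler_nat.
    by move: x1; rewrite /gridpt ler_pdivrMr.
  rewrite ler_pdivrMr // mul1r lerBlDl; apply: le_trans (_ : m.+1%:R <= _).
    by move: x2; rewrite /gridpt ler_pdivlMr.
  by rewrite -natrD ler_nat.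
by rewrite Sword_code sn; field; rewrite !gt_eqF.
Qed.

Lemma char_vec_cell n m : char_vec R n (cell n m) =
  (B^-1, [set v | exists2 z, (z < R)%N /\ neighbour K R n m z & v = z%:R / B]).
Proof.
rewrite /char_vec; congr pair.
  rewrite /norm_length /cell /= /gridpt -mulrBl -natrB ?leqnSn// subSnn exprS.
  by field; rewrite !gt_eqF.
apply/seteqP; split => v /=.
  move=> [s [[sn sJ] /(Sword_image _ sn)/andP[h1 h2]] ->].
  exists (m - code R s)%N; first by split; [lia|exists s; [|lia]].
  rewrite Sword0 sn /cell /= /gridpt natrB// exprS.
  by field; rewrite !gt_eqF.
move=> [z [hz [s [sn sJ] <-]] ->]; exists s.
  by split => //; apply/(Sword_image _ sn); lia.
rewrite Sword0 sn /cell /= /gridpt natrD exprS.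
by field; rewrite !gt_eqF.
Qed.

Definition full_vec : K * set K :=
  (B^-1, [set v | exists2 z, (z < R)%N & v = z%:R / B]).

Lemma char_vec_full n m : char_vec R n (cell n m) = full_vec <->
  forall z, (z < R)%N -> neighbour K R n m z.
Proof.
rewrite char_vec_cell /full_vec; split.
  move=> [/seteqP[_ H]] z hz.
  have [/= z' [_ h]] := H (z%:R / B) (ex_intro2 _ _ z hz erefl).
  by move=> /(mulIf (invr_neq0 (lt0r_neq0 B0)))/eqP; rewrite eqr_nat => /eqP ->.
move=> H; congr pair; apply/seteqP; split => v /= [z hz ->].
  by exists z => //; case: hz.
by exists z => //; split => //; apply: H.
Qed.

Lemma cell_subset n m m' : (m' < R ^ n.+2)%N ->
  net_itv (cell n.+1 m') `<=` net_itv (cell n m) <-> m = (m' %/ R)%N.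
Proof.
move=> hm'.
have gE a : gridpt n a = gridpt n.+1 (R * a).
  by rewrite /gridpt natrM (exprS _ n.+1); field; rewrite !gt_eqF.
have mE := divn_eq m' R; have hr : (m' %% R < R)%N by rewrite ltn_mod; lia.
split.
  move=> H.
  have : net_itv (cell n m) (gridpt n.+1 m').
    by apply: H; rewrite /net_itv /= in_itv /= !gridpt_le; lia.
  have : net_itv (cell n m) (gridpt n.+1 m'.+1).
    by apply: H; rewrite /net_itv /= in_itv /= !gridpt_le; lia.
  rewrite /net_itv /= !in_itv /= !gE !gridpt_le.
  by move: mE hr; set q := (m' %/ R)%N; set r := (m' %% R)%N; nia.
move=> -> x; rewrite /net_itv /= !in_itv /= !gE => /andP[h1 h2]; apply/andP; split.
  by apply: le_trans h1; rewrite gridpt_le; lia.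
by apply: le_trans h2 _; rewrite gridpt_le; lia.
Qed.

Lemma child_cell n m c : (m < R ^ n.+1)%N -> (c < R)%N ->
  (R * m + c < R ^ n.+2)%N.
Proof.
move=> hm hc; rewrite expnS.
by have : (R * m.+1 <= R * R ^ n.+1)%N; [rewrite leq_mul2l hm orbT|lia].
Qed.

Lemma child_intervalP n m c : (m < R ^ n.+2)%N -> (c < R)%N ->
  child_interval R n.+1 (cell n.+2 (R * m + c)) (cell n.+1 m).
Proof.
move=> hm hc; have h := child_cell hm hc.
split; first by apply/net_intervalP; exists m.
  by apply/net_intervalP; exists (R * m + c)%N.
by apply/cell_subset => //; rewrite mulnC divnMDl ?divn_small ?addn0 //; lia.
Qed.

Lemma full_vec_child v : child R v full_vec -> v = full_vec.
Proof.
move=> [[|n] [D' [D [[hD hD' sub] -> E]]]].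
  (* The net interval of generation 0 has normalized length 1, not 1/R. *)
  move: hD E => /net_interval0 -> [+ _]; rewrite /norm_length /= expr0 subr0 mul1r.
  by move=> /eqP; rewrite invr_eq1 => /eqP h; have := R_gt1 K hR; rewrite h ltxx.
move: hD hD' sub E => /net_intervalP[m hm ->] /net_intervalP[m' hm' ->].
move=> /(cell_subset _ hm') mE /esym/char_vec_full H; apply/char_vec_full => z hz.
rewrite (divn_eq m' R) -mE mulnC; apply: neighbour_full_child => //.
by rewrite ltn_mod; lia.
Qed.

Lemma digits10_full n m : (m < R ^ n.+1)%N ->
  char_vec R n.+2 (cell n.+2 (R * (R * m + 1) + 0)) = full_vec.
Proof. by move=> hm; apply/char_vec_full => z hz; apply: neighbour_10. Qed.

Lemma essential_full : essential_class R [set full_vec].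
Proof.
split; last by move=> v' v /= -> /full_vec_child.
split; first by exists full_vec.
  move=> _ /= ->; have h0 : (0 < R ^ 1)%N by rewrite expn1; lia.
  exists 2, (cell 2 (R * (R * 0 + 1) + 0)); split; last by rewrite digits10_full.
  apply/net_intervalP; exists (R * (R * 0 + 1) + 0)%N => //.
  by apply: child_cell; [apply: child_cell|]; lia.
move=> a b /= -> ->; exists 0%N, (fun=> full_vec); split => //.
Qed.

(** Appending the digits 1, 0 leads from any vector to [full_vec], so a closed class contains it; a
    path from there to [v] inside the class can never leave it. *)
Lemma essential_uniq W v : essential_class R W -> W v -> v = full_vec.
Proof.
move=> [[_ sub path] closed] Wv.
suff Wf : W full_vec.
  have [m [g [g0 gm _ gc]]] := path _ _ Wf Wv; rewrite -gm.
  have gE k : (k <= m)%N -> g k = full_vec.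
    elim: k => [//|k IH] hk; apply: full_vec_child.
    by rewrite -(IH (ltnW hk)); apply: gc.
  exact: gE.
have step n m c : (m < R ^ n.+2)%N -> (c < R)%N -> W (char_vec R n.+1 (cell n.+1 m)) ->
    W (char_vec R n.+2 (cell n.+2 (R * m + c))).
  move=> hm hc Wm; apply: closed Wm _.
  by exists n.+1, (cell n.+2 (R * m + c)), (cell n.+1 m); split => //; apply: child_intervalP.
have fin n m : (m < R ^ n.+2)%N -> W (char_vec R n.+1 (cell n.+1 m)) -> W full_vec.
  move=> hm Wm; rewrite -(digits10_full hm); apply: (step); [|lia|apply: (step) => //].
  by apply: child_cell.
have [[|n] [D [hD vE]]] := sub _ Wv; last first.
  by move/net_intervalP: hD vE => [m hm ->] vE; apply: (fin n m); rewrite -?vE.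
have h0 : (0 < R ^ 2)%N by rewrite expn_gt0; lia.
apply: (fin 0%N 0%N) => //; apply: closed Wv _.
exists 0%N, (cell 1 0), D; split => //; split => //.
  by apply/net_intervalP; exists 0%N.
move/net_interval0: hD => -> x.
rewrite /net_itv /= !in_itv /= /gridpt mul0r => /andP[-> /le_trans ->] //.
by rewrite mul1r invf_le1 // exprn_ege1 // ltW ?R_gt1.
Qed.

Lemma fixptE i n : fixpt R i = gridpt n (2 * i * R ^ n) :> K.
Proof.
rewrite /fixpt /gridpt [in RHS]natrM natrX exprS; field.
by rewrite !gt_eqF.
Qed.

Lemma fixpt_not_essential i : ~ in_essential_class R (fixpt R i : K).
Proof.
move=> [W [eW [D [_ hc hx [n0 hW]]]]].
have [_ /net_intervalP[m hm Dm] _] := hc n0.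
have := hx n0.+1; rewrite Dm (fixptE _ n0.+1) /net_itv /= in_itv /= !gridpt_le.
move=> hi.
apply: (@not_full_near_fixpt K R hR hRe i n0.+1 m); first by lia.
by apply/char_vec_full; rewrite -Dm; apply: essential_uniq eW _; apply: hW.
Qed.

(** If [w0] were all zeros after an even [v], or all R - 1 after an odd [v], the left end of the
    interval would be within R^-k of v/R, respectively (v+1)/R, which is a fixed point. The tail
    [w1] allows a prefix of fixed length in words of any length. *)
Lemma far_digits (x : K) k w0 w1 v : (v < R)%N -> digits R w0 -> digits R w1 ->
  size w0 = k ->
  (forall i, (i <= R./2)%N -> 2 * B ^- k < `|x - fixpt R i|) ->
  `|gridpt (size (w0 ++ w1)) (v * R ^ size (w0 ++ w1) + code R (w0 ++ w1)) - x|
     <= B ^- k ->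
  (~~ odd v -> (0 < code R w0)%N) /\ (odd v -> ((code R w0).+1 < R ^ k)%N).
Proof.
set g := gridpt _ _ => hv d0 d1 sk far near; have hh := half_double hRe.
have key i : (i <= R./2)%N -> B ^- k < `|g - fixpt R i|.
  move=> hi; have := far i hi; rewrite -(subrK g x) -addrA => h.
  have := ler_normD (x - g) (g - fixpt R i); rewrite (distrC x) in h *.
  by move=> h'; move: near; lra.
have fE i : fixpt R i = gridpt (size (w0 ++ w1)) (2 * i * R ^ size w0 * R ^ size w1).
  by rewrite (fixptE _ (size (w0 ++ w1))) size_cat expnD mulnA.
have gE : g = gridpt (size (w0 ++ w1))
    ((v * R ^ size w0 + code R w0) * R ^ size w1 + code R w1).
  by rewrite /g code_cat size_cat expnD mulnDl !mulnA addnA.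
have hw1 := code_lt hR hRe d1.
have gap a b d : (a <= d)%N -> (b <= d)%N -> (d <= a + R ^ size w1)%N ->
   (d <= b + R ^ size w1)%N ->
   `|gridpt (size (w0 ++ w1)) a - gridpt (size (w0 ++ w1)) b| <= B ^- k.
  move=> ha hb ha' hb'; rewrite /gridpt -mulrBl normrM (gtr0_norm (x := _^-1)) ?invr_gt0//.
  rewrite ler_pdivrMr //.
  have -> : B ^- k * B ^+ (size (w0 ++ w1)).+1 = (R * R ^ size w1)%:R.
    by rewrite size_cat sk -addnS exprD mulKf ?expf_neq0 ?gt_eqF// exprS natrM natrX.
  have hl : (R ^ size w1 <= R * R ^ size w1)%N by apply: leq_pmull; lia.
  rewrite ler_norml lerNl opprB lerBlDr lerBlDr -!natrD !ler_nat.
  by apply/andP; split; lia.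
split => ov.
  rewrite lt0n; apply/eqP => c0.
  have vE := odd_double_half v; rewrite (negbTE ov) in vE.
  have := key v./2; rewrite ltNge => /(_ _)/negP; apply; first by lia.
  rewrite gE fE c0 addn0; have -> : (2 * v./2 = v)%N by lia.
  by apply: (gap _ _ (v * R ^ size w0 * R ^ size w1 + R ^ size w1)%N); lia.
rewrite ltn_neqAle; have := code_lt hR hRe d0; rewrite sk => -> /=; rewrite andbT.
apply/eqP => c0.
have vE := odd_double_half v; rewrite ov in vE.
have := key (v./2).+1; rewrite ltNge => /(_ _)/negP; apply; first by lia.
rewrite gE fE; have -> : (2 * (v./2).+1 = v.+1)%N by lia.
have E : (v.+1 * R ^ size w0 = (v * R ^ size w0 + code R w0) + 1)%N.
  by rewrite mulSn sk -c0; lia.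
rewrite E (mulnDl _ 1%N) mul1n; set X := (_ * _)%N.
by apply: (gap _ _ (X + R ^ size w1)%N); lia.
Qed.

Lemma invX_small (e : K) : 0 < e -> exists k, B ^- k < e.
Proof.
move=> e0; exists (Num.bound e^-1).
rewrite -[ltRHS]invrK ltf_pV2 ?posrE ?invr_gt0 //.
apply: lt_trans (archi_boundP _) _; first by rewrite invr_ge0 ltW.
by rewrite -natrX ltr_nat ltn_expl.
Qed.

Lemma invX_le k l : (k <= l)%N -> B ^- l <= B ^- k.
Proof. by move=> kl; rewrite lef_pV2 ?posrE // ler_weXn2l // ltW // R_gt1. Qed.

Lemma far_from_fixpts (x : K) : (forall i, (i <= R./2)%N -> x <> fixpt R i) ->
  exists k, forall i, (i <= R./2)%N -> 2 * B ^- k < `|x - fixpt R i|.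
Proof.
have one i : x <> fixpt R i -> exists k, 2 * B ^- k < `|x - fixpt R i|.
  move=> /eqP; rewrite -subr_eq0 -normr_gt0 => e0.
  have [|k hk] := @invX_small (`|x - fixpt R i| / 2); first by rewrite divr_gt0.
  by exists k; rewrite mulrC -ltr_pdivlMr.
elim: (R./2) => [|N IH] H.
  have [k hk] := one 0%N (H 0%N isT).
  by exists k => i; rewrite leqn0 => /eqP ->.
have [|k hk] := IH; first by move=> i hi; apply: H; lia.
have [k' hk'] := one N.+1 (H N.+1 (leqnn _)).
exists (maxn k k') => i; rewrite leq_eqVlt => /orP[/eqP ->|hi].
  by apply: le_lt_trans hk'; rewrite ler_pM2l // invX_le // leq_maxr.
by apply: le_lt_trans (hk i hi); rewrite ler_pM2l // invX_le // leq_maxl.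
Qed.

End Essential.

(** * Points other than the 2i/R are in the essential class *)

Section EssentialPoints.
Variables (K : realType) (R : nat).
Hypotheses (hR : (2 <= R)%N) (hRe : ~~ odd R).
Local Notation B := (R%:R : K).

Let B0 : 0 < B := R_gt0 K hR.
Let Bn0 n : 0 < B ^+ n. Proof. exact: exprn_gt0. Qed.

Lemma fixpt0 : fixpt R 0 = 0 :> K.
Proof. by rewrite /fixpt muln0 mul0r. Qed.

Lemma fixpt_half : fixpt R R./2 = 1 :> K.
Proof.
rewrite /fixpt mul2n -addnn -(half_double hRe) divff // gt_eqF //.
Qed.

Lemma neighbour_parity_full v w c z : (v < R)%N -> digits R w -> (c < R)%N ->
  (z < R)%N -> (~~ odd v -> (0 < code R w)%N) ->
  (odd v -> ((code R w).+1 < R ^ size w)%N) ->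
  neighbour K R (size w).+1 (R * (v * R ^ size w + code R w) + c) z.
Proof.
move=> hv dw hc hz he ho.
pose P w z := neighbour K R (size w) (v * R ^ size w + code R w) z.
have -> : (R * (v * R ^ size w + code R w) + c =
    v * R ^ size (rcons w c) + code R (rcons w c))%N.
  by rewrite code_rcons size_rcons expnS; lia.
rewrite -(size_rcons w c).
apply: (@parity_full K R hR hRe v P) => //.
  by exists [::] => //=; rewrite expn0; lia.
move=> {hc hz he ho dw}w {}z {}c j z' _ Pz _ _ _ jJ E.
rewrite /P code_rcons size_rcons expnS.
have -> : (v * (R * R ^ size w) + (R * code R w + c) =
   R * (v * R ^ size w + code R w) + c)%N by lia.
exact: neighbour_child Pz jJ E.
Qed.

Lemma essential_point (x : K) : 0 <= x <= 1 ->
  (forall i, (i <= R./2)%N -> x <> fixpt R i) -> in_essential_class R x.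
Proof.
move=> /andP[x0 x1] H.
have {}x1 : x < 1.
  by rewrite lt_neqAle x1 andbT -fixpt_half; apply/eqP/H.
pose m n := Num.truncn (x * B ^+ n.+1).
have mlt n : (m n < R ^ n.+1)%N.
  by rewrite /m truncn_lt_nat ?natrX ?gtr_pMl// mulr_ge0// ltW.
have mcell n : gridpt K R n (m n) <= x < gridpt K R n (m n).+1.
  have := truncn_itv (mulr_ge0 x0 (ltW (Bn0 n.+1))); rewrite -/(m n).
  by rewrite /gridpt ler_pdivrMr // ltr_pdivlMr.
have mS n : m n.+1 = (R * m n + m n.+1 %% R)%N.
  rewrite mulnC; suff <- : (m n.+1 %/ R)%N = m n by rewrite -divn_eq.
  have /andP[h1 h2] := mcell n; have /andP[h3 h4] := mcell n.+1.
  have gE a : gridpt K R n a = gridpt K R n.+1 (R * a).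
    by rewrite /gridpt natrM (exprS _ n.+1); field; rewrite !gt_eqF.
  rewrite !gE in h1 h2.
  have := le_lt_trans h1 h4; have := le_lt_trans h3 h2; rewrite !gridpt_lt //.
  move=> h5 h6; apply/eqP; rewrite eqn_leq leq_divRL ?ltn_divRL //; last by lia.
  by rewrite -ltnS ltn_divLR; lia.
have hr n : (m n.+1 %% R < R)%N by rewrite ltn_mod; lia.
have [k hk] := far_from_fixpts hR hRe H.
have hk1 : exists n0, forall n, (n0 <= n)%N ->
    forall z, (z < R)%N -> neighbour K R n (m n) z.
  (* Parity is used once, at generation k + 1; later generations inherit the full neighbour set. *)
  exists k.+1; elim=> [//|n IH].
  rewrite leq_eqVlt => /orP[/eqP [kn]|hn] z hz; last first.
    by rewrite mS; apply: neighbour_full_child => //; apply: IH.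
  rewrite -{n IH}kn.
  have [[|v w] [//= [sw] dvw cE]] := code_surj hR hRe (mlt k).
  have [hv dw] := andP dvw.
  rewrite mS -cE /= -sw.
  have hfar := @far_digits K R hR hRe x k w [::] v hv dw isT sw hk.
  case: hfar => [|he ho].
    rewrite cats0 cE sw.
    have /andP[h1 h2] := mcell k; rewrite distrC ger0_norm ?subr_ge0 //.
    rewrite lerBlDl; apply: le_trans (ltW h2) _.
    rewrite /gridpt -addn1 natrD mulrDl mul1r lerD2l.
    by apply: invX_le.
  by apply: neighbour_parity_full => //; rewrite sw.
exists [set full_vec K R]; split; first exact: essential_full.
exists (fun n => if n is n'.+1 then cell K R n (m n) else (0, 1)); split.
- exact/net_interval0.
- case=> [|n]; last by rewrite mS; apply: child_intervalP.
  split; first exact/net_interval0.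
    by apply/net_intervalP => //; exists (m 1%N).
  move=> y; rewrite /net_itv /= !in_itv /= => /andP[h1 h2]; apply/andP; split.
    by apply: le_trans h1; rewrite divr_ge0 // ltW.
  apply: le_trans h2 _; rewrite /gridpt ler_pdivrMr // mul1r -natrX ler_nat.
  exact: mlt.
- case=> [|n]; first by rewrite /net_itv /= in_itv /= x0 ltW.
  by have /andP[h1 h2] := mcell n.+1; rewrite /net_itv /= in_itv /= h1 ltW.
- have [n0 hn0] := hk1; exists n0.+1; case=> [//|n] hn.
  by apply/char_vec_full => //; apply: hn0; lia.
Qed.

End EssentialPoints.

(** * Local dimensions along geometric sequences of radii *)

Lemma between_bounds (K : realDomainType) (y X k k' c C a a' : K) :
  c + k <= y -> y <= C + k' -> - a <= k - X -> k' - X <= a' -> 0 <= a -> 0 <= a' ->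
  - (`|c| + `|C| + a + a') <= y - X <= `|c| + `|C| + a + a'.
Proof.
move=> h1 h2 h3 h4 h5 h6; apply/andP; split.
  have : - `|c| <= c by rewrite lerNl ler_normr lexx orbT.
  by have := normr_ge0 C; move: h1 h3 h6; clear; lra.
by have := ler_norm C; have := normr_ge0 c; move: h2 h4 h5; clear; lra.
Qed.

Section LogRatio.
Variables (K : realType) (b : K -> K).

(** A bounded error is negligible against [ln r], which tends to minus infinity. *)
Lemma ln_ratio_cvg (d A e : K) : 0 < e ->
  (forall r, 0 < r < e -> `|ln (b r) - d * ln r| <= A) ->
  ln (b r) / ln r @[r --> 0^'+] --> d.
Proof.
move=> e0 H; apply/cvgrPdist_le => eps eps0; near=> r.
have r0 : 0 < r by near: r; exact: nbhs_right_gt.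
have re : r < e by near: r; exact: nbhs_right_lt.
have r1 : r < 1 by near: r; exact: nbhs_right_lt.
have rA : r < expR (- (A / eps)).
  by near: r; apply: nbhs_right_lt; exact: expR_gt0.
have lr0 : ln r < 0 by rewrite ln_lt0 // r0 r1.
have lrA : ln r < - (A / eps).
  by rewrite -(expRK (- (A / eps))) ltr_ln ?posrE // expR_gt0.
have := H r; rewrite r0 re => /(_ isT) h.
have -> : d - ln (b r) / ln r = (d * ln r - ln (b r)) / ln r.
  by field; rewrite lt_eqF.
rewrite normrM normfV (ltr0_norm lr0) ler_pdivrMr ?oppr_gt0 // distrC.
apply: le_trans h _; rewrite mulrC -ler_pdivrMr //.
by rewrite ltW // ltrNr.
Unshelve. all: by end_near.
Qed.

Hypothesis b_homo : forall r r', r <= r' -> b r <= b r'.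

(** Monotonicity of [b] fills the gaps between consecutive radii at the cost of a bounded factor,
    and the two sequences of radii may start at different scales. *)
Lemma geometric_ln_ratio (th q s s' c C : K) : 0 < th < 1 -> 0 < q ->
  0 < s -> 0 < s' -> 0 < c -> 0 < C ->
  (forall k, c * q ^+ k <= b (s * th ^+ k)) ->
  (forall k, b (s' * th ^+ k) <= C * q ^+ k) ->
  ln (b r) / ln r @[r --> 0^'+] --> ln q / ln th.
Proof.
move=> /andP[th0 th1] q0 s0 s'0 c0 C0 lo hi.
have lth : ln th < 0 by rewrite ln_lt0 // th0 th1.
pose A (s : K) := `|ln q| * (1 + `|ln s / ln th|).
apply: (@ln_ratio_cvg _ (`|ln c| + `|ln C| + A s + A s') (Num.min s s')).
  by rewrite lt_min s0 s'0.
move=> r /andP[r0]; rewrite lt_min => /andP[rs rs'].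
(* The real exponent with s th^t = r; rounding it up gives a smaller radius for the lower bound,
   rounding down a larger one for the upper bound. *)
pose t (s : K) := (ln r - ln s) / ln th.
have t_ge0 x : 0 < x -> r < x -> 0 <= t x.
  move=> x0 rx; apply: mulr_le0; last by rewrite invr_le0 ltW.
  by rewrite subr_le0 ltW // ltr_ln.
have key x e k : 0 <= e <= 1 -> `|k%:R - t x| <= e ->
    `|k%:R * ln q - ln q / ln th * ln r| <= A x.
  move=> /andP[e0 e1] hk.
  have -> : k%:R * ln q - ln q / ln th * ln r = ln q * ((k%:R - t x) - ln x / ln th).
    by rewrite /t; field; rewrite lt_eqF.
  rewrite normrM ler_wpM2l // (le_trans (ler_normB _ _)) // lerD2r.
  exact: le_trans e1.
pose k := (Num.truncn (t s)).+1; pose k' := Num.truncn (t s').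
have hk := truncn_itv (t_ge0 _ s0 rs); have hk' := truncn_itv (t_ge0 _ s'0 rs').
have q1 : `|k%:R * ln q - ln q / ln th * ln r| <= A s.
  apply: (key _ 1); rewrite ?ler01 ?lexx //= ler_norml.
  by move: hk; rewrite /k -addn1 natrD; lra.
have q2 : `|k'%:R * ln q - ln q / ln th * ln r| <= A s'.
  apply: (key _ 1); rewrite ?ler01 ?lexx //= ler_norml.
  by move: hk'; rewrite /k' -addn1 natrD; lra.
have h1 : s * th ^+ k <= r.
  rewrite -ler_ln ?posrE ?mulr_gt0 ?exprn_gt0 // lnM ?posrE ?exprn_gt0 //.
  rewrite lnXn // -mulr_natl -lerBrDl -ler_ndivrMr //.
  by have /andP[_ /ltW] := hk.
have h2 := le_trans (lo k) (b_homo h1).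
have b0 : 0 < b r by apply: lt_le_trans h2; rewrite mulr_gt0 // exprn_gt0.
have blo : ln c + k%:R * ln q <= ln (b r).
  by rewrite mulr_natl -lnXn // -lnM ?posrE ?exprn_gt0 // ler_ln ?posrE ?mulr_gt0 ?exprn_gt0.
have bhi : ln (b r) <= ln C + k'%:R * ln q.
  have h : r <= s' * th ^+ k'.
    rewrite -ler_ln ?posrE ?mulr_gt0 ?exprn_gt0 // lnM ?posrE ?exprn_gt0 //.
    rewrite lnXn // -mulr_natl -lerBlDl -ler_ndivlMr //.
    by have /andP[] := hk'.
  rewrite mulr_natl -lnXn // -lnM ?posrE ?exprn_gt0 // ler_ln ?posrE ?mulr_gt0 ?exprn_gt0 //.
  exact: le_trans (b_homo h) (hi k').
have A0 x : 0 <= A x by rewrite mulr_ge0 // addr_ge0.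
move: q1 q2; rewrite !ler_norml => /andP[q1 _] /andP[_ q2].
exact: (between_bounds blo bhi q1 q2 (A0 s) (A0 s')).
Qed.

Lemma linear_large (x M : K) : 0 < x ->
  exists n0, forall n, (n0 <= n)%N -> M <= n%:R * x.
Proof.
move=> x0; exists (Num.bound `|M / x|) => n hn; rewrite -ler_pdivrMr //.
apply: le_trans (ler_norm _) _; apply: le_trans (ltW (archi_boundP (normr_ge0 _))) _.
by rewrite ler_nat.
Qed.

(** Multiplying by [ln r < 0] reverses the order, hence [d + e] on the left. *)
Lemma ln_ratio_near (d e th s : K) : 0 < s -> 0 < th < 1 -> 0 < e ->
  ln (b r) / ln r @[r --> 0^'+] --> d ->
  exists n0, forall n, (n0 <= n)%N ->
    (d + e) * ln (s * th ^+ n) <= ln (b (s * th ^+ n)) <= (d - e) * ln (s * th ^+ n).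
Proof.
move=> s0 /andP[th0 th1] e0 /cvgrPdist_le/(_ e e0)/nbhs_ballP[de /= de0 H].
have lth : ln th < 0 by rewrite ln_lt0 // th0 th1.
pose x := Num.min de 1.
have x0 : 0 < x by rewrite lt_min de0 ltr01.
have nlth : 0 < - ln th by rewrite oppr_gt0.
have [n0 hn0] := linear_large (ln s - ln (x / 2)) nlth.
have {}hn0 : forall n, (n0 <= n)%N -> s * th ^+ n <= x / 2.
  move=> n /hn0 h.
  rewrite -ler_ln ?posrE ?mulr_gt0 ?exprn_gt0 ?invr_gt0 //.
  by rewrite lnM ?posrE ?exprn_gt0 // lnXn // -[ln th *+ n]mulr_natl; lra.
exists n0 => n /hn0 h; set r := s * th ^+ n in h *.
have r0 : 0 < r by rewrite mulr_gt0 // exprn_gt0.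
have x2 : x / 2 < x by rewrite ltr_pdivrMr // ltr_pMr // ltr1n.
have /andP[rd r1] : (r < de) && (r < 1) by rewrite -lt_min; exact: le_lt_trans x2.
have lr0 : ln r < 0 by rewrite ln_lt0 // r0 r1.
have /= := H r; rewrite /ball /= sub0r normrN gtr0_norm // => /(_ rd r0).
rewrite ler_distlC => /andP[h1 h2].
by rewrite -ler_ndivrMr // -ler_ndivlMr // h1 h2.
Qed.

Hypothesis b_gt0 : forall r, 0 < r -> 0 < b r.

(** A dimension below ln q / ln th means decay slower than q^n. Half of the gap is spent on the
    convergence, the other half beats the constants [C] and [s]. *)
Lemma ln_ratio_lt (d q s th C : K) :
  0 < s -> 0 < th < 1 -> 0 < q -> 0 < C ->
  ln (b r) / ln r @[r --> 0^'+] --> d -> d < ln q / ln th ->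
  exists n0, forall n, (n0 <= n)%N -> C * q ^+ n <= b (s * th ^+ n).
Proof.
move=> s0 hth q0 C0 hd dq; have /andP[th0 th1] := hth.
have lth : ln th < 0 by rewrite ln_lt0.
pose e := (ln q / ln th - d) / 2.
have e0 : 0 < e by rewrite divr_gt0 // subr_gt0.
have [n1 hn1] := ln_ratio_near s0 hth e0 hd.
have [|n2 hn2] := @linear_large ((d + e) * ln th - ln q) (ln C - (d + e) * ln s).
  by rewrite subr_gt0 -ltr_ndivlMr // /e; lra.
exists (maxn n1 n2) => n; rewrite geq_max => /andP[/hn1/andP[h _] /hn2 h2].
have r0 : 0 < s * th ^+ n by rewrite mulr_gt0 // exprn_gt0.
rewrite -ler_ln ?posrE ?mulr_gt0 ?exprn_gt0 ?b_gt0 // lnM ?posrE ?exprn_gt0 //.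
apply: le_trans h; rewrite lnM ?posrE ?exprn_gt0 // !lnXn //
  -[ln q *+ n]mulr_natl -[ln th *+ n]mulr_natl.
by move: h2; rewrite mulrBr mulrDr mulrCA; lra.
Qed.

Lemma ln_ratio_gt (d q s th C : K) :
  0 < s -> 0 < th < 1 -> 0 < q -> 0 < C ->
  ln (b r) / ln r @[r --> 0^'+] --> d -> ln q / ln th < d ->
  exists n0, forall n, (n0 <= n)%N -> b (s * th ^+ n) <= C * q ^+ n.
Proof.
move=> s0 hth q0 C0 hd dq; have /andP[th0 th1] := hth.
have lth : ln th < 0 by rewrite ln_lt0.
pose e := (d - ln q / ln th) / 2.
have e0 : 0 < e by rewrite divr_gt0 // subr_gt0.
have [n1 hn1] := ln_ratio_near s0 hth e0 hd.
have [|n2 hn2] := @linear_large (ln q - (d - e) * ln th) ((d - e) * ln s - ln C).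
  by rewrite subr_gt0 -ltr_ndivrMr // /e; lra.
exists (maxn n1 n2) => n; rewrite geq_max => /andP[/hn1/andP[_ h] /hn2 h2].
have r0 : 0 < s * th ^+ n by rewrite mulr_gt0 // exprn_gt0.
rewrite -ler_ln ?posrE ?mulr_gt0 ?exprn_gt0 ?b_gt0 // [leRHS]lnM ?posrE ?exprn_gt0 //.
apply: le_trans h _; rewrite lnM ?posrE ?exprn_gt0 // !lnXn //
  -[ln q *+ n]mulr_natl -[ln th *+ n]mulr_natl.
by move: h2; rewrite mulrBr mulrDr mulrCA; lra.
Qed.

End LogRatio.

(** * The self-similar measure *)

Section Measure.
Variables (K : realType) (R : nat).
Hypotheses (hR : (2 <= R)%N) (hRe : ~~ odd R).
Local Notation B := (R%:R : K).
Variables (p : nat -> K) (pstar : K).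
Hypothesis adm : admissible R p pstar.
Variable mu : probability (measurableTypeR K) K.
Hypothesis ss : self_similar R p mu.

Let B0 : 0 < B := R_gt0 K hR.
Local Notation N a b := (fine (mu `[a, b]%classic)).
Local Notation sumJ F := (\sum_(0 <= j < (R * (R - 1)).+1 | inJ K R j) F j).

Lemma p0_gt0 : 0 < p 0%N.
Proof. by have := adm_t_gt0 adm (leq0n _); rewrite tidx0. Qed.

Lemma pJ_gt0 j : inJ K R j -> 0 < p j.
Proof. by move=> /(adm_min adm); apply: lt_le_trans p0_gt0. Qed.

Lemma sumJ_le (F G : nat -> K) : (forall j, inJ K R j -> F j <= G j) ->
  sumJ F <= sumJ G.
Proof. by move=> H; apply: ler_sum => j; apply: H. Qed.

Lemma sumJ_ge1 (F : nat -> K) i : (forall j, inJ K R j -> 0 <= F j) -> inJ K R i ->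
  F i <= sumJ F.
Proof.
move=> H hi; rewrite big_mkord.
have hi' : (i < (R * (R - 1)).+1)%N by rewrite ltnS; apply: inJ_le hi.
rewrite (bigD1 (Ordinal hi')) //= lerDl sumr_ge0 // => j /andP[hj _].
exact: H.
Qed.

Lemma sumJ_only (F : nat -> K) i : inJ K R i ->
  (forall j, inJ K R j -> j != i -> F j = 0) -> sumJ F = F i.
Proof.
move=> hi H; rewrite big_mkord.
have hi' : (i < (R * (R - 1)).+1)%N by rewrite ltnS; apply: inJ_le hi.
rewrite (bigD1 (Ordinal hi')) //= big1 ?addr0 // => j /andP[hj ji].
by apply: H.
Qed.

Lemma pJ_le1 j : inJ K R j -> p j <= 1.
Proof.
by move=> hj; rewrite -(adm_sum1 adm); apply: sumJ_ge1 => // i /pJ_gt0/ltW.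
Qed.

Lemma sumJ_avg (F : nat -> K) x : (forall j, inJ K R j -> F j <= x) ->
  sumJ (fun j => p j * F j) <= x.
Proof.
move=> H; apply: le_trans (_ : sumJ (fun j => p j * x) <= _).
  by apply: sumJ_le => j hj; rewrite ler_pM2l ?pJ_gt0 // H.
by rewrite -mulr_suml (adm_sum1 adm) mul1r.
Qed.

Lemma p0_lt1 : p 0%N < 1.
Proof.
have R1 : (0 < R * (R - 1))%N by rewrite muln_gt0; lia.
have h0 : inJ K R 0 by rewrite -(tidx0 R); apply: inJ_tidx.
have h1 : inJ K R (R * (R - 1)) by rewrite -(tidx_half hRe); apply: inJ_tidx.
have h1' : (R * (R - 1) < (R * (R - 1)).+1)%N by [].
rewrite -(adm_sum1 adm) big_mkord (bigD1 ord0) //= (bigD1 (Ordinal h1')) /=.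
  rewrite -[ltLHS]addr0 ltrD2l ltr_wpDr ?pJ_gt0 // sumr_ge0 // => j.
  by move=> /andP[/andP[/pJ_gt0/ltW]].
by rewrite h1 /=; apply/eqP => -[E]; rewrite E in R1.
Qed.

Lemma mu_fin (A : set (measurableTypeR K)) : measurable A -> mu A \is a fin_num.
Proof. by move=> mA; apply: fin_num_measure. Qed.

Lemma le_mass (A C : set (measurableTypeR K)) : measurable A -> measurable C ->
  A `<=` C -> fine (mu A) <= fine (mu C).
Proof.
move=> mA mC AC; apply: fine_le; rewrite ?mu_fin //.
by apply: le_measure; rewrite ?inE.
Qed.

Lemma mass_le1 (A : set (measurableTypeR K)) : measurable A -> fine (mu A) <= 1.
Proof.
by move=> mA; rewrite -lee_fin fineK ?mu_fin // probability_le1.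
Qed.

Lemma mass_ge0 (A : set (measurableTypeR K)) : 0 <= fine (mu A).
Proof. by apply: fine_ge0; apply: measure_ge0. Qed.

Lemma measurable_Smap j (A : set (measurableTypeR K)) : measurable A ->
  measurable ((Smap R j : measurableTypeR K -> measurableTypeR K) @^-1` A).
Proof.
move=> mA; rewrite -[X in measurable X]setTI.
have mf : measurable_fun setT (Smap R j : measurableTypeR K -> measurableTypeR K).
  apply: measurable_funD => //; exact: mulrr_measurable.
exact: mf.
Qed.

Lemma mass_self_similar (A : set (measurableTypeR K)) : measurable A ->
  fine (mu A) = sumJ (fun j => p j * fine (mu (Smap R j @^-1` A))).
Proof.
move=> mA; apply: EFin_inj; rewrite fineK ?mu_fin // ss // -sumEFin.
by apply: eq_bigr => j hj; rewrite EFinM fineK // mu_fin //; exact: measurable_Smap.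
Qed.

Lemma Smap_pre j (a x : K) : (a <= Smap R j x) = (B * a - j%:R / B <= x).
Proof.
rewrite lerBlDr -[in LHS](ler_pM2l B0) /Smap; congr (_ <= _).
by field; rewrite gt_eqF.
Qed.

Lemma Smap_pre' j (a x : K) : (Smap R j x <= a) = (x <= B * a - j%:R / B).
Proof.
rewrite lerBrDr -[in LHS](ler_pM2l B0) /Smap; congr (_ <= _).
by field; rewrite gt_eqF.
Qed.

Lemma mass_itv (a b : K) :
  N a b = sumJ (fun j => p j * N (B * a - j%:R / B) (B * b - j%:R / B)).
Proof.
rewrite mass_self_similar //; apply: eq_bigr => j _; congr (_ * fine (mu _)).
by apply/seteqP; split => x /=; rewrite !in_itv /= Smap_pre Smap_pre'.
Qed.

Let Fle t := fine (mu `]-oo, t]%classic).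
Let Fge t := fine (mu `[t, +oo[%classic).

Lemma Fle_ss t : Fle t = sumJ (fun j => p j * Fle (B * t - j%:R / B)).
Proof.
rewrite /Fle mass_self_similar //; apply: eq_bigr => j _; congr (_ * fine (mu _)).
by apply/seteqP; split => x /=; rewrite !in_itv /= Smap_pre'.
Qed.

Lemma Fge_ss t : Fge t = sumJ (fun j => p j * Fge (B * t - j%:R / B)).
Proof.
rewrite /Fge mass_self_similar //; apply: eq_bigr => j _; congr (_ * fine (mu _)).
by apply/seteqP; split => x /=; rewrite !in_itv /= !andbT Smap_pre.
Qed.

Lemma Fle_homo t t' : t <= t' -> Fle t <= Fle t'.
Proof.
move=> h; apply: le_mass => // x /=; rewrite !in_itv /= => /le_trans; exact.
Qed.

Lemma Fge_homo t t' : t' <= t -> Fge t <= Fge t'.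
Proof.
move=> h; apply: le_mass => // x /=; rewrite !in_itv /= !andbT; exact: le_trans.
Qed.

Lemma small_mass (F : nat -> set (measurableTypeR K)) (e : K) : 0 < e ->
  (forall n, measurable (F n)) -> (forall n m, (n <= m)%N -> F m `<=` F n) ->
  (forall x, exists n, ~ F n x) -> exists n, fine (mu (F n)) < e.
Proof.
move=> e0 mF dF H.
have E : \bigcap_n F n = set0.
  by rewrite -subset0 => x Fx; have [n] := H x; apply; apply: Fx.
have : (mu \o F) x @[x --> \oo] --> mu (\bigcap_n F n).
  apply: nonincreasing_cvg_mu => //.
  - by rewrite (le_lt_trans (probability_le1 _ _)) // ltry.
  - by rewrite E.
  - by move=> n m nm; apply/subsetPset/dF.
rewrite E measure0 => /fine_cvgP[_] /cvgrPdist_lt/(_ e e0)[n _ hn].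
exists n; have /= := hn n (leqnn n).
by rewrite sub0r normrN ger0_norm // mass_ge0.
Qed.

(** Self-similarity makes [Fle t] an average of values at points at most [B * t]; iterating bounds
    it by [Fle (B ^+ n * t)], which tends to 0. *)
Lemma Fle_lt0 t : t < 0 -> Fle t = 0.
Proof.
move=> t0; apply/eqP; rewrite eq_le mass_ge0 andbT; apply/ler_addgt0Pl => e e0.
rewrite addr0.
have it n : Fle t <= Fle (B ^+ n * t).
  elim: n => [|n IH]; first by rewrite expr0 mul1r.
  apply: le_trans IH _; rewrite Fle_ss; apply: sumJ_avg => j _; apply: Fle_homo.
  by rewrite exprS -mulrA lerBlDr lerDl divr_ge0.
have [|n m nm|x|n hn] := @small_mass (fun n => `]-oo, B ^+ n * t]%classic) e e0.
- by move=> n; exact: measurable_itv.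
- move=> x /=; rewrite !in_itv /= => /le_trans; apply.
  by rewrite ler_nM2r // ler_weXn2l // ltW // R_gt1.
- have [|k hk'] := @invX_small K R hR (- t / (`|x| + 1)).
    by rewrite divr_gt0 ?oppr_gt0 // ltr_wpDl.
  exists k => /=; rewrite in_itv /= => h; move: hk'.
  have x1 : 0 < `|x| + 1 by rewrite ltr_wpDl.
  rewrite ltr_pdivlMr // mulrC ltr_pdivrMr ?exprn_gt0 //.
  by have := lerNnormlW (lexx `|x|); rewrite mulNr [t * _]mulrC; lra.
by apply: ltW; apply: le_lt_trans (it n) hn.
Qed.

(** The same, expanding about 1: since [j <= R * (R - 1)], every preimage of [t] is at least
    [1 + B * (t - 1)]. *)
Lemma Fge_gt1 t : 1 < t -> Fge t = 0.
Proof.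
move=> t1; apply/eqP; rewrite eq_le mass_ge0 andbT; apply/ler_addgt0Pl => e e0.
rewrite addr0.
have it n : Fge t <= Fge (1 + B ^+ n * (t - 1)).
  elim: n => [|n IH]; first by rewrite expr0 mul1r addrC subrK.
  apply: le_trans IH _; rewrite Fge_ss; apply: sumJ_avg => j jJ; apply: Fge_homo.
  rewrite exprS -mulrA; set y := B ^+ n * (t - 1).
  rewrite lerBrDr mulrDr mulr1 addrAC lerD2r.
  rewrite -(ler_pM2l B0) mulrDr mulrCA divff ?gt_eqF // !mulr1 -natrM -natrD ler_nat.
  have := inJ_le hR hRe jJ; rewrite mulnBr muln1.
  by have : (R <= R * R)%N by [apply: leq_pmull; lia]; lia.
have [|n m nm|x|n hn] := @small_mass (fun n => `[1 + B ^+ n * (t - 1), +oo[%classic) e e0.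
- by move=> n; exact: measurable_itv.
- move=> x /=; rewrite !in_itv /= !andbT; apply: le_trans.
  by rewrite lerD2l ler_pM2r ?subr_gt0 // ler_weXn2l // ltW // R_gt1.
- have [|k hk'] := @invX_small K R hR ((t - 1) / (`|x| + 1)).
    by rewrite divr_gt0 ?subr_gt0 // ltr_wpDl.
  exists k => /=; rewrite in_itv /= andbT => h; move: hk'.
  have x1 : 0 < `|x| + 1 by rewrite ltr_wpDl.
  rewrite ltr_pdivlMr // mulrC ltr_pdivrMr ?exprn_gt0 //.
  by have := ler_norm x; rewrite [(t - 1) * _]mulrC; lra.
by apply: ltW; apply: le_lt_trans (it n) hn.
Qed.

Lemma fix_eq0 (c x : K) : c < 1 -> x = c * x -> x = 0.
Proof.
move=> c1 /eqP; rewrite -subr_eq0 -{1}[x]mul1r -mulrBl mulf_eq0 subr_eq0.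
by rewrite gt_eqF //= => /eqP.
Qed.

(** All letters but 0 pull the half-line back to a null one, so this mass is p_0 times itself and
    p_0 < 1. In particular 0 is not an atom. *)
Lemma Fle_0 : Fle 0 = 0.
Proof.
apply: (fix_eq0 p0_lt1); rewrite {1}Fle_ss (sumJ_only (i := 0)).
- by rewrite mulr0 mul0r subr0.
- by rewrite -(tidx0 R); apply: inJ_tidx.
- move=> j _ j0; rewrite Fle_lt0 ?mulr0 // sub0r oppr_lt0 divr_gt0 // ltr0n.
  by rewrite lt0n.
Qed.

Lemma Fge_1 : Fge 1 = 0.
Proof.
have pe := adm_ends adm.
apply: (fix_eq0 p0_lt1); rewrite {1}Fge_ss (sumJ_only (i := (R * (R - 1))%N)).
- rewrite -pe; congr (_ * Fge _); rewrite natrM mulrAC divff ?gt_eqF // mul1r.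
  by rewrite mulr1 natrB ?(ltnW hR) // opprB addrC subrK.
- by rewrite -(tidx_half hRe); apply: inJ_tidx.
- move=> j jJ j1; rewrite Fge_gt1 ?mulr0 // ltrBrDr mulr1.
  rewrite -(ltr_pM2l B0) mulrDr mulrCA divff ?gt_eqF // !mulr1 -natrM -natrD ltr_nat.
  have := inJ_le hR hRe jJ; rewrite leq_eqVlt (negbTE j1) /= mulnBr muln1.
  by have : (R <= R * R)%N by [apply: leq_pmull; lia]; lia.
Qed.

Lemma mass_union (A C D : set (measurableTypeR K)) : measurable A -> measurable C ->
  measurable D -> A `<=` C `|` D -> fine (mu A) <= fine (mu C) + fine (mu D).
Proof.
move=> mA mC mD AC; rewrite -lee_fin EFinD !fineK ?mu_fin //.
apply: le_trans (_ : mu (C `|` D) <= _)%E; last exact: measureU2.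
by apply: le_measure; rewrite ?inE //; apply: measurableU.
Qed.

Lemma itv_homo (a b a' b' : K) : a' <= a -> b <= b' -> N a b <= N a' b'.
Proof.
move=> ha hb; apply: le_mass => // x /=; rewrite !in_itv /= => /andP[h1 h2].
by rewrite (le_trans ha h1) (le_trans h2 hb).
Qed.

Lemma itv_split (a c b : K) : N a b <= N a c + N c b.
Proof.
apply: mass_union => // x /=; rewrite !in_itv /= => /andP[h1 h2].
by have [h|/ltW h] := leP x c; [left|right]; rewrite ?h1 ?h2 ?h.
Qed.

Lemma itv_left (a b : K) : b <= 0 -> N a b = 0.
Proof.
move=> b0; apply/eqP; rewrite eq_le mass_ge0 andbT -Fle_0.
apply: le_mass => // x /=; rewrite !in_itv /= => /andP[_ h].
exact: le_trans b0.
Qed.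

Lemma itv_right (a b : K) : 1 <= a -> N a b = 0.
Proof.
move=> a1; apply/eqP; rewrite eq_le mass_ge0 andbT -Fge_1.
apply: le_mass => // x /=; rewrite !in_itv /= andbT => /andP[h _].
exact: le_trans h.
Qed.

Lemma itv01 : N 0 1 = 1.
Proof.
apply/eqP; rewrite eq_le mass_le1 //=.
have E : fine (mu setT) = 1 by rewrite probability_setT.
have h1 : fine (mu setT) <= Fle 0 + fine (mu `[0, +oo[%classic).
  apply: mass_union => // x _; have [h|h] := leP x 0; [left|right].
    by rewrite /= in_itv.
  by rewrite /= in_itv /= ltW.
have h2 : fine (mu `[0, +oo[%classic) <= N 0 1 + Fge 1.
  apply: mass_union => // x /=; rewrite in_itv /= andbT => x0.
  have [h|h] := leP x 1; [left|right]; rewrite /= in_itv /= ?x0 ?h //.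
  by rewrite ltW.
by move: h1 h2; rewrite Fle_0 Fge_1 E; lra.
Qed.

End Measure.

(** * Transfer matrices *)

Section NonnegativeMatrices.
Variables (K : realType).

Definition nneg m n (M : 'M[K]_(m, n)) := forall i j, 0 <= M i j.

Definition msum m n (M : 'M[K]_(m, n)) : K := \sum_i \sum_j M i j.

Lemma nneg_mul m n l (M : 'M[K]_(m, n)) (N : 'M[K]_(n, l)) :
  nneg M -> nneg N -> nneg (M *m N).
Proof. by move=> hM hN i j; rewrite mxE sumr_ge0 // => k _; rewrite mulr_ge0. Qed.

Lemma msum_ge0 m n (M : 'M[K]_(m, n)) : nneg M -> 0 <= msum M.
Proof. by move=> hM; rewrite sumr_ge0 // => i _; rewrite sumr_ge0. Qed.

Lemma entry_le_msum m n (M : 'M[K]_(m, n)) i j : nneg M -> M i j <= msum M.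
Proof.
move=> hM; rewrite /msum (bigD1 i) //= (bigD1 j) //= -addrA lerDl addr_ge0 //.
  by rewrite sumr_ge0.
by rewrite sumr_ge0 // => k _; rewrite sumr_ge0.
Qed.

Lemma row_le_msum m n (M : 'M[K]_(m, n)) i : nneg M -> \sum_j M i j <= msum M.
Proof.
move=> hM; rewrite /msum (bigD1 i) //= lerDl.
by rewrite sumr_ge0 // => k _; rewrite sumr_ge0.
Qed.

Lemma row_mul m n l (M : 'M[K]_(m, n)) (N : 'M[K]_(n, l)) i :
  \sum_j (M *m N) i j = \sum_k M i k * \sum_j N k j.
Proof.
under eq_bigr do rewrite mxE; rewrite exchange_big /=.
by apply: eq_bigr => k _; rewrite mulr_sumr.
Qed.

Lemma msum_mul_le m n l (M : 'M[K]_(m, n)) (N : 'M[K]_(n, l)) :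
  nneg M -> nneg N -> msum (M *m N) <= msum M * msum N.
Proof.
move=> hM hN; rewrite /msum mulr_suml; apply: ler_sum => i _.
rewrite row_mul mulr_suml; apply: ler_sum => k _.
by rewrite ler_wpM2l // row_le_msum.
Qed.

(** With [msum_mul_le] this gives multiplicativity up to constants across a positive middle
    factor. *)
Lemma msum_mul3_ge m n l o (M : 'M[K]_(m, n)) (U : 'M[K]_(n, l)) (N : 'M[K]_(l, o)) ka :
  nneg M -> nneg N -> (forall i j, ka <= U i j) ->
  ka * (msum M * msum N) <= msum (M *m U *m N).
Proof.
move=> hM hN hU; rewrite -mulmxA.
rewrite mulrCA {1 3}/msum mulr_suml; apply: ler_sum => i _.
rewrite row_mul mulr_suml; apply: ler_sum => k _; rewrite ler_wpM2l //.
rewrite row_mul mulr_sumr; apply: ler_sum => j _.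
by rewrite ler_wpM2r // sumr_ge0.
Qed.

Lemma colsum_mul_ge m n (M : 'M[K]_(m, n)) (N : 'M[K]_n) la a : nneg N -> 0 <= la ->
  (forall k, la <= \sum_i M i k) -> (forall k, a <= \sum_i N i k) ->
  forall k, la * a <= \sum_i (M *m N) i k.
Proof.
move=> hN la0 hM hN' k.
under eq_bigr do rewrite mxE; rewrite exchange_big /=.
apply: le_trans (_ : la * \sum_i N i k <= _); first by rewrite ler_wpM2l.
rewrite mulr_sumr; apply: ler_sum => i _.
by rewrite -mulr_suml ler_wpM2r.
Qed.

End NonnegativeMatrices.

Section Transfer.
Variables (K : realType) (R : nat).
Hypotheses (hR : (2 <= R)%N) (hRe : ~~ odd R).
Local Notation B := (R%:R : K).
Variables (p : nat -> K) (pstar : K).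
Hypothesis adm : admissible R p pstar.
Local Notation p0 := (p 0%N).

Let B0 : 0 < B := R_gt0 K hR.

(** The sum has at most one term; written as a sum, the entry is 0 when the required letter is
    negative or outside J. *)
Definition transfer (c : nat) : 'M[K]_R := \matrix_(v, z)
  \sum_(0 <= j < (R * (R - 1)).+1 | inJ K R j && (j + z == R * v + c)%N) p j.

Definition transferw (w : seq nat) : 'M[K]_R :=
  foldr (fun c M => transfer c *m M) 1%:M w.

Lemma transferw_cat s t : transferw (s ++ t) = transferw s *m transferw t.
Proof.
by elim: s => [|c s IH] /=; rewrite ?mul1mx // IH mulmxA.
Qed.

Lemma transferw_rcons w c : transferw (rcons w c) = transferw w *m transfer c.
Proof. by rewrite -cats1 transferw_cat /= mulmx1. Qed.

Lemma nneg_transfer c : nneg (transfer c).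
Proof.
by move=> i j; rewrite mxE sumr_ge0 // => k /andP[/(pJ_gt0 adm)/ltW].
Qed.

Lemma nneg_transferw w : nneg (transferw w).
Proof.
elim: w => [|c w IH] /=; last by apply: nneg_mul => //; exact: nneg_transfer.
by move=> i j; rewrite mxE ler0n.
Qed.

Lemma transfer_ge c (v z : 'I_R) j : inJ K R j -> (j + z = R * v + c)%N ->
  p j <= transfer c v z.
Proof.
move=> hj E; rewrite mxE big_mkord.
have hj' : (j < (R * (R - 1)).+1)%N by rewrite ltnS; apply: inJ_le hj.
rewrite (bigD1 (Ordinal hj')) /=; last by rewrite hj E eqxx.
by rewrite lerDl sumr_ge0 // => i /andP[/andP[/(pJ_gt0 adm)/ltW]].
Qed.

Lemma transfer_le1 c v z : transfer c v z <= 1.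
Proof.
rewrite mxE -(adm_sum1 adm) [leLHS]big_mkcondr; apply: ler_sum => j hj.
by case: ifP => // _; rewrite ltW // (pJ_gt0 adm).
Qed.

(** A crude bound, meant for words of bounded length. *)
Lemma msum_transferw_le w : msum (transferw w) <= R%:R * (R%:R ^+ 2) ^+ size w.
Proof.
elim: w => [|c w IH] /=.
  rewrite expr0 mulr1 /msum; apply: le_trans (_ : \sum_(i < R) 1 <= _); last first.
    by rewrite sumr_const card_ord.
  apply: ler_sum => i _; rewrite (bigD1 i) //= big1 ?mxE ?eqxx ?addr0 //.
  by move=> j ji; rewrite mxE eq_sym (negbTE ji).
rewrite exprS mulrCA.
apply: le_trans (msum_mul_le (nneg_transfer c) (nneg_transferw w)) _.
apply: ler_pM => //; try by apply: msum_ge0; [exact: nneg_transfer|exact: nneg_transferw].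
- by apply: msum_ge0; exact: nneg_transfer.
- by apply: msum_ge0; exact: nneg_transferw.
apply: le_trans (_ : \sum_(i < R) \sum_(j < R) 1 <= _).
  by apply: ler_sum => i _; apply: ler_sum => j _; exact: transfer_le1.
under eq_bigr do rewrite sumr_const card_ord.
by rewrite sumr_const card_ord -(mulr_natr (R%:R : K)) expr2.
Qed.

(** The path v, 1, z: the letter [R * v] reaches state 1 through the digit 1, and the odd state 1
    reaches every [z] through the digit 0. *)
Lemma transfer10_ge (v z : 'I_R) : p0 ^+ 2 <= transferw [:: 1; 0]%N v z.
Proof.
have p00 := p0_gt0 adm.
rewrite /= mulmx1 mxE (bigD1 (Ordinal hR)) //= -[leLHS]addr0 lerD //; last first.
  by rewrite sumr_ge0 // => i _; rewrite mulr_ge0 //; exact: nneg_transfer.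
rewrite expr2; apply: ler_pM; try exact: ltW.
  apply: le_trans (_ : p (R * v)%N <= _).
    by apply: (adm_min adm); apply: mulR_inJ.
  by apply: transfer_ge => //; apply: mulR_inJ.
have [j jJ E] := odd_step K hR hRe (isT : odd 1) hR (ltn_ord z : (0 <= z < R)%N).
by apply: le_trans (transfer_ge jJ _) => //; exact: (adm_min adm).
Qed.

Hypothesis hstar : pstar <= 2 * p0.

(** If [c] and [z] differ, row 0 or row 1 already contributes a letter of I. If they agree, rows 0
    and R - 1 contribute the two extreme letters, of total weight 2 p_0; this is where [hstar]
    enters. *)
Lemma colsum_transfer_ge c (z : 'I_R) : (c < R)%N ->
  pstar <= \sum_v transfer c v z.
Proof.
move=> hc; have R0 : (0 < R)%N by lia.
have hz := ltn_ord z.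
have T0 v : 0 <= transfer c v z by exact: nneg_transfer.
have RR : (R <= R * (R - 1))%N by apply: leq_pmulr; lia.
have [cz|cz|cz] := ltngtP c z.
- have [j jJ E] := odd_step K hR hRe (isT : odd 1) hR (c := c) (z' := z)
    (introT andP (conj (ltnW cz) (ltn_ord z))).
  have jI : inI K R j.
    have -> : j = (2 * 0 * R + (R - (z - c)))%N by lia.
    by apply: block_inI => //; move: RR; set X := (R * (R - 1))%N; lia.
  rewrite (bigD1 (Ordinal hR)) //= -(adm_star adm jI) -[leLHS]addr0 lerD ?sumr_ge0 //.
  by apply: transfer_ge => //=; rewrite E.
- have jI : inI K R (c - z).
    have -> : (c - z = 2 * 0 * R + (c - z))%N by lia.
    by apply: block_inI => //; move: RR; set X := (R * (R - 1))%N; lia.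
  rewrite (bigD1 (Ordinal R0)) //= -(adm_star adm jI) -[leLHS]addr0 lerD ?sumr_ge0 //.
  apply: transfer_ge => /=; last by rewrite muln0 subnK // ltnW.
  by apply/inJP; left.
have R1 : (R - 1 < R)%N by lia.
rewrite (bigD1 (Ordinal R0)) //= (bigD1 (Ordinal R1)) //=; last first.
  by apply/eqP => -[]; lia.
have h0 : p0 <= transfer c (Ordinal R0) z.
  by apply: transfer_ge; [rewrite -(tidx0 R); apply: inJ_tidx|rewrite /=; lia].
have h1 : p0 <= transfer c (Ordinal R1) z.
  rewrite (adm_ends adm); apply: transfer_ge => /=; last by lia.
  by apply: mulR_inJ.
apply: le_trans hstar _; rewrite mulr_natl mulr2n lerD //.
by rewrite -[leLHS]addr0 lerD ?sumr_ge0.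
Qed.

Lemma msum_transferw_ge w : digits R w -> pstar ^+ size w <= msum (transferw w).
Proof.
move=> dw.
have ps0 := adm_star_gt0 adm.
have R0 : (0 < R)%N by lia.
have H : forall k, pstar ^+ size w <= \sum_i transferw w i k.
  elim: w dw => [|c w IH] /=.
    by move=> _ k; rewrite (bigD1 k) //= mxE eqxx lerDl sumr_ge0 // => i _; rewrite mxE ler0n.
  move=> /andP[hc /IH{}IH] k; rewrite exprS; apply: colsum_mul_ge => //.
  - exact: nneg_transferw.
  - exact: ltW.
  - by move=> z; apply: colsum_transfer_ge.
rewrite /msum exchange_big /= (bigD1 (Ordinal R0)) //=.
rewrite -[leLHS]addr0 lerD // sumr_ge0 // => i _; rewrite sumr_ge0 // => j _.
exact: nneg_transferw.
Qed.

Lemma transferw_parity_full (v : 'I_R) w c (z : 'I_R) : digits R w -> (c < R)%N ->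
  (~~ odd v -> (0 < code R w)%N) ->
  (odd v -> ((code R w).+1 < R ^ size w)%N) ->
  p0 ^+ (size w).+1 <= transferw (rcons w c) v z.
Proof.
move=> dw hc he ho; have p00 := p0_gt0 adm.
(* [parity_full] speaks of natural numbers, so the column index is quantified over its ordinal
   representatives. *)
pose P w (z : nat) := forall y : 'I_R, y = z :> nat -> p0 ^+ size w <= transferw w v y.
suff : P (rcons w c) z by move=> /(_ z erefl); rewrite size_rcons.
apply: (@parity_full K R hR hRe v P) => //.
  by move=> y /val_inj ->; rewrite expr0 /= mxE eqxx.
move=> {hc he ho dw}w {}z {}c j z' _ Pz hz _ _ jJ E y yz.
rewrite size_rcons transferw_rcons mxE (bigD1 (Ordinal hz)) //=.
rewrite -[leLHS]addr0 lerD //; last first.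
  rewrite sumr_ge0 // => i _; apply: mulr_ge0; first exact: nneg_transferw.
  exact: nneg_transfer.
have p0_ge0 := ltW p00.
rewrite exprSr; apply: ler_pM => //; [exact: exprn_ge0|exact: Pz|].
apply: le_trans (transfer_ge jJ _); first exact: (adm_min adm).
by rewrite yz.
Qed.

End Transfer.

(** * Masses of net intervals as matrix products *)

Section CellMass.
Variables (K : realType) (R : nat).
Hypotheses (hR : (2 <= R)%N) (hRe : ~~ odd R).
Local Notation B := (R%:R : K).
Variables (p : nat -> K) (pstar : K).
Hypothesis adm : admissible R p pstar.
Local Notation p0 := (p 0%N).
Variable mu : probability (measurableTypeR K) K.
Hypothesis ss : self_similar R p mu.

Let B0 : 0 < B := R_gt0 K hR.
Let Bn0 n : 0 < B ^+ n. Proof. exact: exprn_gt0. Qed.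
Let p00 : 0 < p0 := p0_gt0 adm.
Local Notation N a b := (fine (mu `[a, b]%classic)).
Local Notation T := (transfer R p).
Local Notation Tw := (transferw R p).

Definition cell_mass n m : K := N (gridpt K R n m) (gridpt K R n m.+1).

(** The row is the first digit: the relevant interval has the digits v :: w, and self-similarity
    consumes digits from the left. *)
Definition cell_masses (w : seq nat) : 'M[K]_(R, 1) :=
  \matrix_(v, _) cell_mass (size w) (v * R ^ size w + code R w).

Lemma cell_mass_ge0 n m : 0 <= cell_mass n m.
Proof. exact: mass_ge0. Qed.

Lemma cell_masses_cons c w : digits R w ->
  cell_masses (c :: w) = T c *m cell_masses w.
Proof.
move=> dw; apply/matrixP => v i; rewrite !mxE /=.
set n := size w; pose M := (v * R ^ n.+1 + (c * R ^ n + code R w))%N.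
have hw : (code R w < R ^ n)%N by exact: code_lt.
have ptE j m : B * gridpt K R n.+1 m - j%:R / B = (m%:R - (j * R ^ n)%:R) / B ^+ n.+1.
  rewrite /gridpt natrM natrX !exprS; field.
  by rewrite expf_neq0 ?gt_eqF.
have ME : M = ((R * v + c) * R ^ n + code R w)%N by rewrite /M expnS; lia.
rewrite /cell_mass (mass_itv hR ss) -/M.
under [RHS]eq_bigr do rewrite !mxE mulr_suml.
rewrite (exchange_big_dep (fun j => inJ K R j)) /=; last by move=> z j _ /andP[].
apply: eq_bigr => j jJ; rewrite !ptE.
(* For each letter only [z = R * v + c - j] can contribute; if it is not in [0, R), the preimage of
   the interval falls outside (0, 1) and is null. *)
have [hj|hj] := leqP j (R * v + c); last first.
  rewrite big1 => [|z /andP[_ /eqP]]; last by lia.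
  rewrite (itv_left hR hRe adm ss) ?mulr0 // pmulr_lle0 ?invr_gt0 // subr_le0 ler_nat.
  have : ((R * v + c).+1 * R ^ n <= j * R ^ n)%N by rewrite leq_mul2r hj orbT.
  by rewrite ME mulSn; lia.
have [hz|hz] := ltnP (R * v + c - j) R; last first.
  rewrite big1 => [|z /andP[_ /eqP]]; last by have := ltn_ord z; lia.
  rewrite (itv_right hR hRe adm ss) ?mulr0 // ler_pdivlMr // mul1r.
  rewrite lerBrDr -natrX -natrD ler_nat.
  have : ((j + R) * R ^ n <= (R * v + c) * R ^ n)%N by rewrite leq_mul2r; apply/orP; right; lia.
  by rewrite ME mulnDl expnS; lia.
rewrite (bigD1 (Ordinal hz)) /=; last by rewrite jJ /= subnKC.
rewrite big1 ?addr0 => [|z /andP[/andP[_ /eqP E] /eqP[]]]; last first.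
  by apply: val_inj => /=; lia.
have E m : (m%:R - (j * R ^ n)%:R) / B ^+ n.+1 = gridpt K R n (m - j * R ^ n) \/ (m < j * R ^ n)%N.
  by have [h|h] := leqP (j * R ^ n) m; [left; rewrite /gridpt natrB|right].
have jM : (j * R ^ n <= M)%N.
  by have : (j * R ^ n <= (R * v + c) * R ^ n)%N by [rewrite leq_mul2r hj orbT]; lia.
have [->|] := E M; last by lia.
have [->|] := E M.+1; last by lia.
by rewrite subSn // ME -addnBAC ?leq_mul2r ?hj ?orbT // -mulnBl.
Qed.

Lemma cell_massesE w : digits R w ->
  cell_masses w = Tw w *m cell_masses [::].
Proof.
elim: w => [|c w IH] /=; first by rewrite mul1mx.
by move=> /andP[_ dw]; rewrite cell_masses_cons // IH // mulmxA.
Qed.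

Lemma cell_masses_cat s t : digits R s -> digits R t ->
  cell_masses (s ++ t) = Tw s *m cell_masses t.
Proof.
move=> ds dt; rewrite cell_massesE ?(cell_massesE dt) ?mulmxA ?transferw_cat //.
by rewrite /digits all_cat; apply/andP.
Qed.

Lemma nneg_cell_masses w : nneg (cell_masses w).
Proof. by move=> i j; rewrite mxE cell_mass_ge0. Qed.

Lemma cell_mass_le_transferw w (v : 'I_R) : digits R w ->
  cell_masses w v ord0 <= msum (Tw w).
Proof.
move=> dw; rewrite cell_massesE // mxE.
apply: le_trans (row_le_msum v (nneg_transferw adm w)).
apply: ler_sum => z _; rewrite -[leRHS]mulr1; apply: ler_wpM2l.
  exact: (nneg_transferw adm).
by rewrite mxE mass_le1.
Qed.

(** Only an inequality: the closed intervals overlap at their end points, and interior atoms have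
    not been excluded. *)
Lemma sum_cell_masses : 1 <= \sum_(v < R) cell_masses [::] v ord0.
Proof.
have H n : N 0 (n%:R / B) <= \sum_(v < n) cell_mass 0 v.
  elim: n => [|n IH]; first by rewrite mul0r (itv_left hR hRe adm ss) // big_ord0.
  rewrite big_ord_recr /=; apply: le_trans (itv_split mu 0 (n%:R / B) _) _.
  by rewrite lerD // /cell_mass /gridpt expr1.
have := H R; rewrite divff ?gt_eqF // (itv01 hR hRe adm ss) => h.
apply: le_trans h _; apply: ler_sum => v _.
by rewrite mxE /= expn0 muln1 addn0.
Qed.

(** The interval with digit v contains the one with digits v, 1, 0, to which the positive matrix
    applies. *)
Lemma cell_masses_nil_ge (v : 'I_R) : p0 ^+ 2 <= cell_masses [::] v ord0.
Proof.
have d10 : digits R [:: 1; 0]%N by rewrite /digits /= hR; lia.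
apply: le_trans (_ : cell_masses [:: 1; 0]%N v ord0 <= _).
  rewrite cell_massesE // mxE.
  apply: le_trans (_ : p0 ^+ 2 * \sum_z cell_masses [::] z ord0 <= _).
    by rewrite ler_peMr ?sum_cell_masses // exprn_ge0 // ltW.
  rewrite mulr_sumr; apply: ler_sum => z _; rewrite ler_wpM2r ?nneg_cell_masses //.
  exact: (transfer10_ge hR hRe adm).
rewrite !mxE /= /cell_mass; apply: itv_homo; rewrite !expn0 !expn1 !muln1 /gridpt.
- rewrite ler_pdivrMr // mulrAC ler_pdivlMr // -!natrX -!natrM ler_nat.
  by rewrite !expnS !expn0 !muln1; nia.
- rewrite ler_pdivrMr // mulrAC ler_pdivlMr // -!natrX -!natrM ler_nat.
  by rewrite !expnS !expn0 !muln1; nia.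
Qed.

(** Converse of [cell_mass_le_transferw], valid behind a prefix whose row [v] is positive. *)
Lemma cell_mass_ge_transferw s t (v : 'I_R) ka : digits R s -> digits R t ->
  0 <= ka -> (forall z, ka <= Tw s v z) ->
  ka * p0 ^+ 2 * msum (Tw t) <= cell_masses (s ++ t) v ord0.
Proof.
move=> ds dt ka0 H; rewrite cell_masses_cat // mxE -mulrA /msum mulr_sumr mulr_sumr.
apply: ler_sum => z _; rewrite (cell_massesE dt) mxE.
have h : p0 ^+ 2 * \sum_y Tw t z y <= \sum_y Tw t z y * cell_masses [::] y ord0.
  rewrite mulr_sumr; apply: ler_sum => y _; rewrite mulrC ler_wpM2l //.
    exact: (nneg_transferw adm).
  exact: cell_masses_nil_ge.
apply: ler_pM => //; rewrite mulr_ge0 ?sumr_ge0 // => [|y _].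
  by rewrite exprn_ge0 // ltW.
exact: (nneg_transferw adm).
Qed.

Lemma cell_mass_gt0_lt n m : 0 < cell_mass n m -> (m < R ^ n.+1)%N.
Proof.
rewrite ltnNge => h; apply/negP => hm; move: h.
rewrite /cell_mass (itv_right hR hRe adm ss) ?ltxx //.
by rewrite /gridpt ler_pdivlMr // mul1r -natrX ler_nat.
Qed.

End CellMass.

(** * Comparison of balls with matrix products *)

Section Growth.
Variables (K : realType) (R : nat).
Hypotheses (hR : (2 <= R)%N) (hRe : ~~ odd R).
Local Notation B := (R%:R : K).
Variables (p : nat -> K) (pstar : K).
Hypothesis adm : admissible R p pstar.
Local Notation p0 := (p 0%N).
Variable mu : probability (measurableTypeR K) K.
Hypothesis ss : self_similar R p mu.

Let B0 : 0 < B := R_gt0 K hR.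
Let Bn0 n : 0 < B ^+ n. Proof. exact: exprn_gt0. Qed.
Let p00 : 0 < p0 := p0_gt0 adm.
Local Notation N a b := (fine (mu `[a, b]%classic)).
Local Notation Tw := (transferw R p).
Local Notation ball_mass x r := (N (x - r) (x + r)).

Lemma gridptS n m : gridpt K R n m.+1 = gridpt K R n m + B ^- n.+1.
Proof. by rewrite /gridpt -addn1 natrD mulrDl mul1r. Qed.

(** The ball has diameter at most the length of a grid interval, so it is covered by the two
    intervals at the grid point nearest to [x], one of which carries half its mass. *)
Lemma heavy_cell n (x : K) : 0 <= x -> exists m,
  ball_mass x (B ^- n.+2) / 2 <= cell_mass R mu n m /\
  x - B ^- n <= gridpt K R n m /\ gridpt K R n m.+1 <= x + B ^- n.
Proof.
move=> x0; pose e := B ^- n.+1.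
have e0 : 0 < e by rewrite invr_gt0.
have B2 : 2 <= B by rewrite ler_nat.
have e1 : 2 * B ^- n.+2 <= e.
  rewrite /e (exprS _ n.+1) invfM mulrA ler_piMl ?invr_ge0 ?(ltW (Bn0 _)) //.
  by rewrite ler_pdivrMr // mul1r.
have e2 : 2 * e <= B ^- n.
  rewrite /e exprS invfM mulrA ler_piMl ?invr_ge0 ?(ltW (Bn0 _)) //.
  by rewrite ler_pdivrMr // mul1r.
have y0 : 0 <= x * B ^+ n.+1 + 1 / 2 by rewrite addr_ge0 // mulr_ge0 // ltW.
pose m := Num.truncn (x * B ^+ n.+1 + 1 / 2).
have /andP[m1 m2] := truncn_itv y0; rewrite -/m in m1 m2.
have g1 : gridpt K R n m <= x + e / 2.
  rewrite /gridpt ler_pdivrMr // mulrDl; apply: le_trans m1 _; rewrite lerD2l.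
  by rewrite /e mulrAC mulVf ?gt_eqF.
have g2 : x - e / 2 <= gridpt K R n m.
  rewrite /gridpt ler_pdivlMr // mulrBl /e mulrAC mulVf ?gt_eqF //.
  by move: m2; rewrite -[m.+1%:R]natr1; lra.
have gS i : gridpt K R n i.+1 = gridpt K R n i + e by exact: gridptS.
have split2 := itv_split mu (x - B ^- n.+2) (gridpt K R n m) (x + B ^- n.+2).
have right_le : N (gridpt K R n m) (x + B ^- n.+2) <= cell_mass R mu n m.
  by apply: itv_homo; rewrite ?gS //; lra.
have [h|h] := leP (ball_mass x (B ^- n.+2) / 2) (cell_mass R mu n m).
  by exists m; split => //; rewrite gS; split; lra.
(* For [m = 0] there is no interval on the left, but the part of the ball below 0 is null. *)
case: (posnP m) => [m0|].
  have left0 : N (x - B ^- n.+2) (gridpt K R n m) = 0.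
    by apply: (itv_left hR hRe adm ss); rewrite m0 /gridpt mul0r.
  have := mass_ge0 mu `[x - B ^- n.+2, x + B ^- n.+2]%classic.
  by exists m; split; [lra|rewrite gS; split; lra].
move=> mgt0; exists m.-1; have E := gS m.-1; rewrite prednK // in E *.
have left_le : N (x - B ^- n.+2) (gridpt K R n m) <= cell_mass R mu n m.-1.
  by rewrite /cell_mass prednK //; apply: itv_homo => //; lra.
by split; [lra|split; lra].
Qed.

(** Take the digits of a heavy interval near [x]. Being far from the fixed points makes row [v]
    positive after k + 1 further digits, so its mass is comparable to the entry sum of the remaining
    word; adding the prefix back costs at most the factor [D]. *)
Lemma near_word (x : K) : 0 <= x -> (forall i, (i <= R./2)%N -> x <> fixpt R i) ->
  (forall r, 0 < r -> 0 < ball_mass x r) ->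
  exists2 c, 0 < c & exists n0, forall n, (n0 <= n)%N -> exists w,
    [/\ size w = n, digits R w, ball_mass x (B ^- n.+2) / 2 <= msum (Tw w) &
        c * msum (Tw w) <= ball_mass x (B ^- n)].
Proof.
move=> x0 xf pos; have [k hk] := far_from_fixpts hR hRe xf.
pose D : K := B * (B ^+ 2) ^+ k.+1.
have D0 : 0 < D by rewrite mulr_gt0 // !exprn_gt0.
exists (p0 ^+ k.+1 * p0 ^+ 2 / D); first by rewrite divr_gt0 // mulr_gt0 // exprn_gt0.
exists k.+1 => n hn; have [m [m1 [m2 m3]]] := heavy_cell n x0.
have mlt : (m < R ^ n.+1)%N.
  apply: (cell_mass_gt0_lt hR hRe adm ss (mu := mu)); apply: lt_le_trans m1.
  by rewrite divr_gt0 // pos // invr_gt0.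
have [[|v w] [//= [sw] dvw cE]] := code_surj hR hRe mlt.
have [hv dw] := andP dvw.
have mE : cell_mass R mu n m = cell_masses R mu w (Ordinal hv) ord0.
  by rewrite mxE /= sw -cE sw.
have cw := cell_mass_le_transferw hR hRe adm ss (Ordinal hv) dw.
rewrite -mE in cw; exists w; split => //; first exact: le_trans cw.
have hs : (k < size w)%N by rewrite sw.
have wE := cat_take_drop k w.
have : digits R (take k w ++ drop k w) by rewrite wE.
rewrite /digits all_cat => /andP[d0 d1].
have st : size (take k w) = k by rewrite size_take hs.
have [he ho] : (~~ odd v -> (0 < code R (take k w))%N) /\
    (odd v -> ((code R (take k w)).+1 < R ^ k)%N).
  apply: (far_digits hR hRe hv d0 d1 st hk).
  rewrite wE sw -[n in (v * R ^ n)%N]sw cE ler_norml.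
  have hkn : B ^- n <= B ^- k by apply: invX_le => //; exact: ltnW.
  by move: m2 m3; rewrite gridptS; have : 0 < B ^- n.+1 by [rewrite invr_gt0]; lra.
case wd : (drop k w) d1 wE => [|c t] d1 wE.
  by move: hs; rewrite -wE size_cat st addn0 ltnn.
have [hc dt] := andP d1.
have ds : digits R (rcons (take k w) c) by rewrite /digits all_rcons hc.
have full z : p0 ^+ k.+1 <= Tw (rcons (take k w) c) (Ordinal hv) z.
  rewrite -[in leLHS]st; apply: (transferw_parity_full hR hRe adm) => //.
  by rewrite st.
have := cell_mass_ge_transferw hR hRe adm ss ds dt (exprn_ge0 _ (ltW p00)) full.
rewrite cat_rcons wE -mE => h.
apply: le_trans (_ : cell_mass R mu n m <= _); last by apply: itv_homo.
apply: le_trans h; rewrite mulrAC ler_pdivrMr // -[leRHS]mulrA.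
rewrite ler_pM2l ?mulr_gt0 ?exprn_gt0 // mulrC -wE -cat_rcons transferw_cat.
apply: le_trans (msum_mul_le (nneg_transferw adm _) (nneg_transferw adm _)) _.
rewrite ler_wpM2r ?msum_ge0 //; first exact: (nneg_transferw adm).
by have := msum_transferw_le adm (rcons (take k w) c); rewrite size_rcons st.
Qed.

End Growth.

(** * Points with a prescribed growth rate *)

Section Sequences.
Variable K : realType.

Lemma nested_itv (x e : nat -> K) : (forall k, 0 <= e k) ->
  (forall k, x k <= x k.+1) -> (forall k, x k.+1 + e k.+1 <= x k + e k) ->
  exists y, forall k, x k <= y <= x k + e k.
Proof.
move=> e0 xS eS.
have xmono k j : (k <= j)%N -> x k <= x j.
  elim: j => [|j IH]; first by rewrite leqn0 => /eqP ->.
  by rewrite leq_eqVlt => /orP[/eqP -> //|/IH h]; exact: le_trans h (xS j).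
have emono k j : (k <= j)%N -> x j + e j <= x k + e k.
  elim: j => [|j IH]; first by rewrite leqn0 => /eqP ->.
  by rewrite leq_eqVlt => /orP[/eqP -> //|/IH h]; exact: le_trans (eS j) h.
have ub k : ubound (range x) (x k + e k).
  move=> _ [j _ <-]; have [kj|jk] := leqP k j.
    by apply: le_trans (emono _ _ kj); rewrite lerDl.
  by apply: le_trans (xmono _ _ (ltnW jk)) _; rewrite lerDl.
exists (sup (range x)) => k; apply/andP; split.
  by apply: (@ub_le_sup _ (range x)); [exists (x 0%N + e 0%N)|exists k].
by apply: ge_sup; [exists (x 0%N), 0%N|].
Qed.

(** [A] is submultiplicative and [ka * A] supermultiplicative. Comparing both at the index k j puts
    every (ka A_k)^(1/k) below every A_j^(1/j); [q] is the supremum of the former. *)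
Lemma fekete (A : nat -> K) (ka : K) : 0 < ka -> (forall k, 0 < A k) ->
  (forall k j, A (k + j)%N <= A k * A j) ->
  (forall k j, ka * (A k * A j) <= A (k + j)%N) ->
  exists q, 0 < q /\ forall k, q ^+ k <= A k <= ka^-1 * q ^+ k.
Proof.
move=> ka0 A0 sub sup_.
have A01 : 1 <= A 0%N.
  by have := sub 0%N 0%N; rewrite addn0 -[leLHS]mul1r ler_pM2r.
have kaA : ka * A 0%N <= 1.
  by have := sup_ 0%N 0%N; rewrite addn0 mulrA -[leRHS]mul1r ler_pM2r.
have ka1 : ka <= 1 by apply: le_trans kaA; rewrite ler_pMr.
have up k j : A (k * j.+1)%N <= A k ^+ j.+1.
  elim: j => [|j IH]; first by rewrite muln1 expr1.
  by rewrite mulnS exprS; apply: le_trans (sub _ _) _; rewrite ler_pM2l.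
have lo k j : (ka * A k) ^+ j.+1 <= ka * A (k * j.+1)%N.
  elim: j => [|j IH]; first by rewrite muln1 expr1.
  rewrite mulnS exprS; apply: le_trans (_ : ka * A k * (ka * A (k * j.+1)%N) <= _).
    by rewrite ler_pM2l // mulr_gt0.
  set X := A (k * _)%N.
  have -> : ka * A k * (ka * X) = ka * (ka * (A k * X)) by ring.
  by rewrite ler_pM2l //; exact: sup_.
have cross k j : j.+1%:R * ln (ka * A k.+1) <= k.+1%:R * ln (A j.+1).
  rewrite !mulr_natl -!lnXn ?mulr_gt0 // ler_ln ?posrE ?exprn_gt0 ?mulr_gt0 //.
  apply: le_trans (lo _ _) _; rewrite mulnC; apply: le_trans (up _ _).
  by rewrite ler_piMl // ltW.
pose S := range (fun k => ln (ka * A k.+1) / k.+1%:R).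
have ubS j : ubound S (ln (A j.+1) / j.+1%:R).
  move=> _ [k _ <-]; rewrite ler_pdivrMr ?ltr0n // mulrAC ler_pdivlMr ?ltr0n //.
  by rewrite mulrC [leRHS]mulrC.
have hS k : ln (ka * A k.+1) <= k.+1%:R * sup S <= ln (A k.+1).
  apply/andP; split.
    rewrite [leRHS]mulrC -ler_pdivrMr ?ltr0n //.
    have hub : has_ubound S by exists (ln (A 1%N) / 1%:R); exact: (ubS 0%N).
    by apply: (ub_le_sup hub); exists k.
  rewrite mulrC -ler_pdivlMr ?ltr0n //.
  by apply: ge_sup; [exists (ln (ka * A 1%N) / 1%:R), 0%N|exact: ubS].
exists (expR (sup S)); split; first exact: expR_gt0.
case=> [|k].
  by rewrite expr0 A01 mulr1 -[leRHS]mul1r -ler_pdivrMr ?invr_gt0 // invrK mulrC.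
have /andP[h1 h2] := hS k; rewrite -expRM_natl; apply/andP; split.
  by rewrite -[leRHS]lnK ?posrE // ler_expR.
rewrite ler_pdivlMl // -[leLHS]lnK ?posrE ?mulr_gt0 //.
by rewrite ler_expR.
Qed.

End Sequences.

(** * Points defined by concatenated blocks *)

Section Construction.
Variables (K : realType) (R : nat).
Hypotheses (hR : (2 <= R)%N) (hRe : ~~ odd R).
Local Notation B := (R%:R : K).
Variables (p : nat -> K) (pstar : K).
Hypothesis adm : admissible R p pstar.
Local Notation p0 := (p 0%N).
Variable mu : probability (measurableTypeR K) K.
Hypothesis ss : self_similar R p mu.

Let B0 : 0 < B := R_gt0 K hR.
Let Bn0 n : 0 < B ^+ n. Proof. exact: exprn_gt0. Qed.
Let p00 : 0 < p0 := p0_gt0 adm.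
Local Notation N a b := (fine (mu `[a, b]%classic)).
Local Notation Tw := (transferw R p).
Local Notation ball_mass x r := (N (x - r) (x + r)).
Local Notation u := [:: 1; 0]%N.

Fixpoint blocks (a : nat -> seq nat) (k : nat) : seq nat :=
  if k is k'.+1 then blocks a k' ++ (u ++ a k') else [::].

Lemma digits_u : digits R u.
Proof. by rewrite /digits /= hR (ltnW hR). Qed.

Lemma digits_blocks a k : (forall i, digits R (a i)) -> digits R (blocks a k).
Proof.
move=> da; elim: k => [//|k IH]; have := digits_u; rewrite /digits /= => du.
have := da k; rewrite /digits => dak.
by rewrite all_cat /= dak !andbT; apply/andP; split => //; case/and3P: du => -> ->.
Qed.

Lemma size_blocks a k l : (forall i, size (a i) = l) ->
  size (blocks a k) = (k * l.+2)%N.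
Proof.
by move=> sa; elim: k => [//|k IH] /=; rewrite size_cat IH /= sa mulSn addnC.
Qed.

(* The digits 1, 0 at the start of every block keep [y] away from the end
   points of the net intervals containing it. *)
Lemma block_point (a : nat -> seq nat) l : (forall i, size (a i) = l) ->
  (forall i, digits R (a i)) ->
  exists y : K, 0 < y < B^-1 /\ forall k,
    let m := code R (u ++ blocks a k) in let n := (k * l.+2).+2 in
    gridpt K R n m <= y - B ^- n.+3 /\ y + B ^- n.+3 <= gridpt K R n m.+1.
Proof.
move=> sa da.
pose x k := gridpt K R (k * l.+2).+2 (code R (u ++ blocks a k)).
pose e k := B ^- (k * l.+2).+3.
have e0 k : 0 < e k by rewrite invr_gt0.
have B2 : 2 <= B by rewrite ler_nat.
(* [e k] is the length of the k-th interval; the digits 1, 0 contribute 1/R of it and [a k] at most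
   a further R^-2. *)
have xE k : x k.+1 = x k + e k * (B^-1 + (code R (a k))%:R / B ^+ l.+2).
  have -> : x k.+1 = gridpt K R (k.+1 * l.+2).+2
      (code R (u ++ blocks a k) * R ^ l.+2 + (R ^ l.+1 + code R (a k))).
    rewrite /x; congr (gridpt _ _ _ _).
    have -> : u ++ blocks a k.+1 = (u ++ blocks a k) ++ (u ++ a k) by [].
    have cu : code R (u ++ a k) = (R ^ l.+1 + code R (a k))%N.
      by rewrite /= sa mul1n mul0n.
    by rewrite code_cat cu size_cat sa.
  rewrite /x /e /gridpt; move: (code R (u ++ blocks a k)) => cm.
  rewrite !natrD natrM !natrX mulSn.
  have -> : B ^+ (l.+2 + k * l.+2).+3 = B ^+ l.+2 * B ^+ (k * l.+2).+3.
    by rewrite -exprD !addnS.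
  rewrite (exprS B l.+1); field.
  by rewrite !gt_eqF.
have eS k : e k.+1 = e k / B ^+ l.+2.
  by rewrite /e mulSn -invfM -exprD addnC -!addSn.
have a0 k : 0 <= (code R (a k))%:R / B ^+ l.+2 by rewrite divr_ge0 // ltW.
have a1 k : ((code R (a k))%:R + 1) / B ^+ l.+2 <= B ^- 2.
  rewrite ler_pdivrMr // -[l.+2]addn2 exprD mulrC mulfK ?gt_eqF //.
  by rewrite natr1 -natrX ler_nat -(sa k); apply: code_lt.
(* Leaves a margin of R^-2 of the length on the right; on the left the digit 1 leaves 1/R. *)
have B2' : B^-1 + 2 * B ^- 2 <= 1.
  rewrite -(ler_pM2l (Bn0 2)) mulrDr mulrCA divff ?gt_eqF // expr2 -mulrA.
  by rewrite divff ?gt_eqF //; nra.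
have lo k : x k + e k / B <= x k.+1.
  by rewrite xE lerD2l ler_pM2l // lerDl.
have hi k : x k.+1 + e k.+1 <= x k + e k * (1 - B ^- 2).
  rewrite xE eS -addrA lerD2l -mulrDr ler_pM2l //.
  have := a1 k; rewrite mulrDl mul1r; lra.
have [|k|k|y hy] := @nested_itv _ x e.
- by move=> k; exact: ltW.
- by apply: le_trans (lo k); rewrite lerDl divr_ge0 // ltW.
- apply: le_trans (hi k) _; by rewrite lerD2l ler_piMr ?(ltW (e0 k)) // gerBl.
exists y; split.
  have /andP[h1 _] := hy 1%N; have /andP[_ h2] := hy 0%N.
  have x0 : x 0%N = B ^- 2.
    by rewrite /x /gridpt /= addn0 mul0n !mul1n expn1 exprS; field; rewrite gt_eqF.
  have e0' : e 0%N = B ^- 3 by rewrite /e mul0n.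
  apply/andP; split.
    apply: lt_le_trans h1; apply: lt_le_trans (lo 0%N).
    by rewrite x0 addr_gt0 ?divr_gt0 ?invr_gt0.
  apply: le_lt_trans h2 _; rewrite x0 e0' -(ltr_pM2l (Bn0 3)) mulrDr divff ?gt_eqF //.
  have -> : B ^+ 3 / B ^+ 2 = B by field; rewrite gt_eqF.
  have -> : B ^+ 3 / B = B * B by field; rewrite gt_eqF.
  by nra.
move=> k m n.
have -> : B ^- n.+3 = e k * B ^- 2 by rewrite /e /n -invfM -exprD addn2.
have -> : gridpt K R n m.+1 = x k + e k by rewrite gridptS.
have -> : gridpt K R n m = x k by [].
have /andP[h1 h2] := hy k.+1.
have B1 : B ^- 2 <= B^-1.
  by rewrite expr2 invfM ler_piMr ?invr_ge0 ?(ltW B0) // invf_le1 //; lra.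
have := lo k; have := hi k; rewrite mulrBr mulr1 => h3 h4.
have : e k * B ^- 2 <= e k / B by rewrite ler_pM2l.
by split; lra.
Qed.

Lemma small_not_fixpt (y : K) : 0 < y < B^-1 ->
  forall i, (i <= R./2)%N -> y <> fixpt R i.
Proof.
move=> /andP[y0 y1] [|i] _ E; first by move: y0; rewrite E fixpt0 ltxx.
move: y1; rewrite E /fixpt -[ltRHS]mul1r ltr_pM2r ?invr_gt0 // (ltr_nat K _ 1).
by lia.
Qed.

Lemma supp_ball_mass (x : K) : (forall r, 0 < r -> 0 < ball_mass x r) -> supp mu x.
Proof.
move=> H r r0.
have r2 : 0 < r / 2 by rewrite divr_gt0.
have : (0 < mu `[(x - r / 2)%R, (x + r / 2)%R]%classic)%E.
  by rewrite -(fineK (mu_fin mu (measurable_itv _))) lte_fin H.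
move=> /lt_le_trans; apply; apply: le_measure; rewrite ?inE //.
move=> z /=; rewrite !in_itv /= => /andP[h1 h2].
by apply/andP; split; lra.
Qed.

Lemma essential_dim (y d : K) : 0 < y < B^-1 ->
  (forall r, 0 < r -> 0 < ball_mass y r) -> has_local_dim mu y d ->
  local_dims mu (supp mu `&` in_essential_class R) d.
Proof.
move=> hy pos hd; exists y => //; split; first exact: supp_ball_mass.
apply: essential_point => //; last exact: small_not_fixpt.
have /andP[y0 y1] := hy; rewrite ltW //=.
by apply: le_trans (ltW y1) _; rewrite invf_le1 // ler1n; lia.
Qed.

Lemma block_dim (a : nat -> seq nat) l (q c C : K) : (forall i, size (a i) = l) ->
  (forall i, digits R (a i)) -> 0 < q -> 0 < c -> 0 < C ->
  (forall k, c * q ^+ k <= msum (Tw (blocks a k)) <= C * q ^+ k) ->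
  local_dims mu (supp mu `&` in_essential_class R) (ln q / ln (B ^- l.+2)).
Proof.
move=> sa da q0 c0 C0 H; have [y [hy yk]] := block_point sa da.
have R0 : (0 < R)%N by lia.
pose v : 'I_R := Ordinal R0.
pose w k := u ++ blocks a k.
have dw k : digits R (w k).
  by rewrite /w /digits all_cat; apply/andP; split; [exact: digits_u|exact: digits_blocks].
have cE k : cell_masses R mu (w k) v ord0 =
    cell_mass R mu (k * l.+2).+2 (code R (w k)).
  by rewrite mxE mul0n add0n /w size_cat (size_blocks _ sa).
pose th : K := B ^- l.+2.
have thE k s : B ^- s * th ^+ k = B ^- (k * l.+2 + s).
  by rewrite /th exprVn -exprM -invfM -exprD addnC mulnC.
have B1 := R_gt1 K hR.
have th01 : 0 < th < 1.
  by rewrite invr_gt0 Bn0 invf_lt1 // exprn_egt1.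
(* The interval of generation n = k(l+2) + 2 has length R^-(n+1), which is this radius, so the ball
   contains it. In [hi] the radius is R^-(n+3), the margin of [block_point], so the ball lies inside
   it. *)
have lo k : c * p0 ^+ 4 * q ^+ k <= ball_mass y (B ^- 3 * th ^+ k).
  rewrite thE addn3; have [h1 h2] := yk k.
  have e3 : 0 < B ^- (k * l.+2).+2.+3 by rewrite invr_gt0.
  apply: le_trans (_ : cell_mass R mu (k * l.+2).+2 (code R (w k)) <= _); last first.
    rewrite gridptS in h2; apply: itv_homo; rewrite ?gridptS.
      by rewrite lerBlDr; apply: le_trans h2; rewrite lerDl ltW.
    by rewrite lerD2r; apply: le_trans h1 _; rewrite gerBl ltW.
  rewrite -cE; have u2 : 0 <= p0 ^+ 2 by rewrite exprn_ge0 // ltW.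
  apply: le_trans (cell_mass_ge_transferw hR hRe adm ss digits_u (digits_blocks k da) u2
     (transfer10_ge hR hRe adm v)).
  rewrite -exprD [c * _]mulrC -mulrA ler_pM2l ?exprn_gt0 //.
  by have /andP[] := H k.
have hi k : ball_mass y (B ^- 5 * th ^+ k) <= msum (Tw u) * C * q ^+ k.
  rewrite thE -addn3 !addnS addn0; have [h1 h2] := yk k.
  apply: le_trans (_ : cell_mass R mu (k * l.+2).+2 (code R (w k)) <= _).
    exact: itv_homo.
  rewrite -cE; apply: le_trans (cell_mass_le_transferw hR hRe adm ss v (dw k)) _.
  rewrite /w transferw_cat.
  apply: le_trans (msum_mul_le (nneg_transferw adm _) (nneg_transferw adm _)) _.
  rewrite -mulrA ler_wpM2l ?msum_ge0 //; first exact: (nneg_transferw adm).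
  by have /andP[] := H k.
have pos r : 0 < r -> 0 < ball_mass y r.
  move=> r0.
  have [k hk] := @invX_small K R hR (r) r0.
  apply: lt_le_trans (_ : 0 < c * p0 ^+ 4 * q ^+ k) _.
    by rewrite !mulr_gt0 // exprn_gt0.
  apply: le_trans (lo k) _; rewrite thE.
  have : B ^- (k * l.+2 + 3) <= B ^- k.
    by apply: invX_le => //; exact: leq_trans (leq_pmulr _ _) (leq_addr _ _).
  by move=> h; apply: itv_homo; lra.
apply: essential_dim hy pos _.
apply: (@geometric_ln_ratio _ (fun r => ball_mass y r) _ th q (B ^- 3) (B ^- 5)
  (c * p0 ^+ 4) (msum (Tw u) * C)) => //.
- by move=> r r' rr; apply: itv_homo; [rewrite lerD2l lerN2|rewrite lerD2l].
- by rewrite invr_gt0.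
- by rewrite invr_gt0.
- by rewrite mulr_gt0 // exprn_gt0.
- rewrite mulr_gt0 //; apply: lt_le_trans (entry_le_msum v v (nneg_transferw adm u)).
  by apply: lt_le_trans (transfer10_ge hR hRe adm v v); rewrite exprn_gt0.
Qed.

End Construction.

(** * The essential dimensions form an interval *)

Section EssentialDims.
Variables (K : realType) (R : nat).
Hypotheses (hR : (2 <= R)%N) (hRe : ~~ odd R).
Local Notation B := (R%:R : K).
Variables (p : nat -> K) (pstar : K).
Hypothesis adm : admissible R p pstar.
Local Notation p0 := (p 0%N).
Variable mu : probability (measurableTypeR K) K.
Hypothesis ss : self_similar R p mu.
Hypothesis hstar : pstar <= 2 * p0.

Let B0 : 0 < B := R_gt0 K hR.
Let Bn0 n : 0 < B ^+ n. Proof. exact: exprn_gt0. Qed.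
Let p00 : 0 < p0 := p0_gt0 adm.
Local Notation N a b := (fine (mu `[a, b]%classic)).
Local Notation Tw := (transferw R p).
Local Notation ball_mass x r := (N (x - r) (x + r)).
Local Notation u := [:: 1; 0]%N.
Local Notation ess := (local_dims mu (supp mu `&` in_essential_class R)).

Lemma msum_transferw_gt0 w : digits R w -> 0 < msum (Tw w).
Proof.
move=> dw; apply: lt_le_trans (msum_transferw_ge hR hRe adm hstar dw).
by rewrite exprn_gt0 // (adm_star_gt0 adm).
Qed.

Lemma msum_cat_le s t : msum (Tw (s ++ t)) <= msum (Tw s) * msum (Tw t).
Proof.
rewrite transferw_cat.
exact: msum_mul_le (nneg_transferw adm _) (nneg_transferw adm _).
Qed.

Lemma msum_cat_ge s t :
  p0 ^+ 2 * (msum (Tw s) * msum (Tw t)) <= msum (Tw (s ++ (u ++ t))).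
Proof.
rewrite !transferw_cat mulmxA; apply: msum_mul3_ge.
- exact: (nneg_transferw adm).
- exact: (nneg_transferw adm).
- exact: (transfer10_ge hR hRe adm).
Qed.

Lemma blocks_add w k j :
  blocks (fun=> w) (k + j) = blocks (fun=> w) k ++ blocks (fun=> w) j.
Proof.
elim: j => [|j IH]; first by rewrite addn0 cats0.
by rewrite addnS -[LHS]/(blocks _ (k + j) ++ (u ++ w)) IH -catA.
Qed.

(** [is_interval] allows the empty set, so a point is exhibited: the periodic expansion 0, 1, 0, 1,
    0, ..., whose growth rate exists by [fekete]. *)
Lemma ess_nonempty : ess !=set0.
Proof.
pose a (i : nat) : seq nat := [::].
pose A k := msum (Tw (blocks a k)).
have da i : digits R (a i) by [].
have A0 k : 0 < A k by apply: msum_transferw_gt0; exact: (digits_blocks hR k da).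
have u0 : 0 < msum (Tw u) by apply: msum_transferw_gt0; exact: (digits_u hR).
have p2 : 0 < p0 ^+ 2 by rewrite exprn_gt0.
have [|//|k j|k j|q [q0 hq]] := @fekete K A (p0 ^+ 2 / msum (Tw u)).
- by rewrite divr_gt0.
- by rewrite /A blocks_add; exact: msum_cat_le.
- rewrite mulrAC ler_pdivrMr //.
  apply: le_trans (msum_cat_ge _ _) _.
  (* The inserted [u] is one period too many; removing it costs the factor [msum (Tw u)] in the
     constant. *)
  have -> : blocks a k ++ (u ++ blocks a j) = blocks a (k + j) ++ u.
    have -> : u ++ blocks a j = blocks a (1 + j) by rewrite /a (blocks_add [::] 1).
    have -> : blocks a (k + j) ++ u = blocks a (k + j + 1).
      by rewrite /a (blocks_add [::] _ 1).
    by rewrite -addnA (addnC j) /a (blocks_add [::] k).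
  exact: msum_cat_le.
exists (ln q / ln (B ^- 2)).
apply: (block_dim hR hRe adm ss (a := a) (c := 1)
  (C := (p0 ^+ 2 / msum (Tw u))^-1)) => //.
  by rewrite invr_gt0 divr_gt0.
by move=> k; rewrite mul1r; apply: hq.
Qed.

Fixpoint greedy (q : K) (a b : seq nat) (k : nat) : seq nat :=
  if k is k'.+1 then
    let w := greedy q a b k' in
    w ++ (u ++ (if msum (Tw w) <= q ^+ k' then a else b))
  else [::].

(** Appending [u ++ a] multiplies the entry sum by at least [q], appending [u ++ b] by at most [q].
    Correcting towards q^k at each step therefore keeps the ratio bounded on both sides. *)
Lemma greedy_dim (a b : seq nat) l (q : K) : size a = l -> size b = l ->
  digits R a -> digits R b -> 0 < q -> q <= p0 ^+ 2 * msum (Tw a) ->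
  msum (Tw u) * msum (Tw b) <= q -> ess (ln q / ln (B ^- l.+2)).
Proof.
move=> sa sb da db q0 qa qb.
pose M k := msum (Tw (greedy q a b k)).
pose f i := if M i <= q ^+ i then a else b.
have fE k : blocks f k = greedy q a b k by elim: k => [//|k IH] /=; rewrite IH.
have du := digits_u hR.
have a0 := msum_transferw_gt0 da; have b0 := msum_transferw_gt0 db.
have u0 := msum_transferw_gt0 du.
have p2 : 0 < p0 ^+ 2 by rewrite exprn_gt0.
have M_ge0 k : 0 <= M k by apply: msum_ge0; exact: (nneg_transferw adm).
(* [c] is the worst loss in one step with [b], [C] the worst gain with [a]. The values 1 and [B]
   account for the empty word, whose matrix is the identity of entry sum R. *)
pose c := Num.min 1 (p0 ^+ 2 * msum (Tw b) / q).
pose C := Num.max B (msum (Tw u) * msum (Tw a) / q).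
have c0 : 0 < c by rewrite lt_min ltr01 divr_gt0 // mulr_gt0.
have C0 : 0 < C by rewrite lt_max B0.
apply: (block_dim hR hRe adm ss (a := f) (c := c) (C := C)) => //.
- by move=> i; rewrite /f; case: ifP.
- by move=> i; rewrite /f; case: ifP.
move=> k; rewrite fE -/(M k); elim: k => [|k /andP[IH1 IH2]].
  rewrite expr0 !mulr1; apply/andP; split.
    rewrite ge_min; apply/orP; left.
    have R0 : (0 < R)%N := ltnW hR.
    apply: le_trans (entry_le_msum (Ordinal R0) (Ordinal R0) (nneg_transferw adm _)).
    by rewrite mxE.
  by rewrite le_max; apply/orP; left; have := msum_transferw_le adm [::]; rewrite expr0 mulr1.
have qk : 0 < q ^+ k by rewrite exprn_gt0.
have cq : c * q <= p0 ^+ 2 * msum (Tw b).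
  by rewrite -ler_pdivlMr // ge_min lexx orbT.
have Cq : msum (Tw u) * msum (Tw a) <= C * q.
  by rewrite -ler_pdivrMr // le_max lexx orbT.
rewrite /M /= -/(M k); set w := greedy q a b k.
rewrite exprS; case: ifP => [h|/negbT]; last rewrite -ltNge => h.
  apply/andP; split.
    apply: le_trans (msum_cat_ge w a); rewrite -/(M k).
    have -> : p0 ^+ 2 * (M k * msum (Tw a)) = p0 ^+ 2 * msum (Tw a) * M k by ring.
    have -> : c * (q * q ^+ k) = q * (c * q ^+ k) by ring.
    by apply: ler_pM => //; rewrite ?ltW // mulr_gt0.
  apply: le_trans (msum_cat_le w (u ++ a)) _; rewrite -/(M k).
  apply: le_trans (_ : M k * (msum (Tw u) * msum (Tw a)) <= _).
    by rewrite ler_wpM2l // msum_cat_le.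
  have -> : C * (q * q ^+ k) = q ^+ k * (C * q) by ring.
  by apply: ler_pM => //; rewrite mulr_ge0 // ltW.
apply/andP; split.
  apply: le_trans (msum_cat_ge w b); rewrite -/(M k).
  have -> : p0 ^+ 2 * (M k * msum (Tw b)) = p0 ^+ 2 * msum (Tw b) * M k by ring.
  rewrite mulrA; apply: ler_pM => //; try exact: ltW.
  by rewrite mulr_ge0 // ltW.
apply: le_trans (msum_cat_le w (u ++ b)) _; rewrite -/(M k).
apply: le_trans (_ : M k * q <= _).
  by rewrite ler_wpM2l // (le_trans (msum_cat_le u b)).
by rewrite mulrCA mulrC ler_pM2l // mulrC [leRHS]mulrC ler_pM2l.
Qed.

Lemma supp_pos (x : K) : supp mu x -> forall r, 0 < r -> 0 < ball_mass x r.
Proof.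
move=> sx r r0; rewrite -lte_fin (fineK (mu_fin mu (measurable_itv _))).
apply: lt_le_trans (sx r r0) _; apply: le_measure; rewrite ?inE //.
by move=> z /=; rewrite !in_itv /= => /andP[/ltW -> /ltW ->].
Qed.

Lemma supp_itv (x : K) : supp mu x -> 0 <= x <= 1.
Proof.
move=> /supp_pos sx; apply/andP; split; rewrite leNgt; apply/negP => h.
  have := sx (- x) (ltac:(by rewrite oppr_gt0)).
  by rewrite (itv_left hR hRe adm ss) ?subrr ?ltxx.
have := sx (x - 1) (ltac:(by rewrite subr_gt0)).
by rewrite (itv_right hR hRe adm ss) ?subKr ?ltxx.
Qed.

Lemma ess_near_word (x : K) : supp mu x -> in_essential_class R x ->
  exists2 c, 0 < c & exists n0, forall n, (n0 <= n)%N -> exists w,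
    [/\ size w = n, digits R w, ball_mass x (B ^- n.+2) / 2 <= msum (Tw w) &
        c * msum (Tw w) <= ball_mass x (B ^- n)].
Proof.
move=> sx ex; have /andP[x0 _] := supp_itv sx.
apply: (near_word hR hRe adm ss) => //; last exact: supp_pos.
by move=> i _ xi; apply: (fixpt_not_essential hR hRe (K := K) (i := i)); rewrite -xi.
Qed.

Lemma ball_mass_homo (x r r' : K) : r <= r' -> ball_mass x r <= ball_mass x r'.
Proof. by move=> rr; apply: itv_homo; [rewrite lerD2l lerN2|rewrite lerD2l]. Qed.

Lemma invB_itv : 0 < B^-1 < 1.
Proof. by rewrite invr_gt0 B0 invf_lt1 // R_gt1. Qed.

Lemma ess_le (d : K) : ess d -> d <= ln pstar / ln B^-1.
Proof.
move=> [x [sx ex] hd]; rewrite leNgt; apply/negP => dp.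
have ps0 := adm_star_gt0 adm.
have [c c0 [n1 hn1]] := ess_near_word sx ex.
(* A larger dimension would bound the ball by (c/2) p*^n, while the column sums bound it below by c
   p*^n. *)
have c2 : 0 < c / 2 by rewrite divr_gt0.
have [n2 hn2] := ln_ratio_gt (supp_pos sx) ltr01 invB_itv ps0 c2 hd dp.
have [w [sw dw _ h]] := hn1 _ (leq_maxl n1 n2).
have := hn2 _ (leq_maxr n1 n2); rewrite mul1r exprVn => h2.
have := msum_transferw_ge hR hRe adm hstar dw; rewrite sw => h3.
have := le_trans h h2; rewrite mulrAC ler_pdivlMr // => h4.
have pn : 0 < c * pstar ^+ (maxn n1 n2) by rewrite mulr_gt0 // exprn_gt0.
have : c * pstar ^+ (maxn n1 n2) <= c * msum (Tw w) by rewrite ler_pM2l.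
by lra.
Qed.

Lemma ess_interval : is_interval ess.
Proof.
move=> d1 d2 e1 e2 g /andP[].
rewrite le_eqVlt => /orP[/eqP <- //|d1g].
rewrite le_eqVlt => /orP[/eqP -> //|gd2].
have [x [sx ex] hx] := e1; have [y [sy ey] hy] := e2.
have [c1 c10 [n1 hn1]] := ess_near_word sx ex.
have [c2 c20 [n2 hn2]] := ess_near_word sy ey.
have lB : 0 < ln B by rewrite ln_gt0 // R_gt1.
pose q := expR (- (g * ln B)).
have q0 : 0 < q by exact: expR_gt0.
have lq : ln q / ln B^-1 = g.
  by rewrite /q expRK lnV ?posrE // invrN mulrNN mulfK // gt_eqF.
have du := digits_u hR.
have u0 := msum_transferw_gt0 du.
have p2 : 0 < p0 ^+ 2 by rewrite exprn_gt0.
have s2 : 0 < B ^- 2 by rewrite invr_gt0.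
have q2 : 0 < q ^+ 2 by rewrite exprn_gt0.
(* Both constants are tuned so that words [a] and [b] of one common length n satisfy the hypotheses
   of [greedy_dim] at rate q^(n+2), where n + 2 is the length of a block with its prefix [u]. *)
have C1 : 0 < 2 * q ^+ 2 / p0 ^+ 2 by rewrite divr_gt0 // mulr_gt0.
have C2 : 0 < c2 * q ^+ 2 / msum (Tw u) by rewrite divr_gt0 // mulr_gt0.
rewrite -{1}lq in d1g; rewrite -{1}lq in gd2.
have [m1 hm1] := ln_ratio_lt (supp_pos sx) s2 invB_itv q0 C1 hx d1g.
have [m2 hm2] := ln_ratio_gt (supp_pos sy) ltr01 invB_itv q0 C2 hy gd2.
pose n := maxn (maxn n1 n2) (maxn m1 m2).
have leq_n i j : (i <= j)%N -> (j <= n)%N -> (i <= n)%N by exact: leq_trans.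
have [a [sa da ha _]] := hn1 n (leq_n _ _ (leq_maxl _ _) (leq_maxl _ _)).
have [b [sb db _ hb]] := hn2 n (leq_n _ _ (leq_maxr _ _) (leq_maxl _ _)).
have {}hm1 := hm1 n (leq_n _ _ (leq_maxl _ _) (leq_maxr _ _)).
have {}hm2 := hm2 n (leq_n _ _ (leq_maxr _ _) (leq_maxr _ _)).
rewrite exprVn -invfM -exprD add2n in hm1.
rewrite mul1r exprVn in hm2.
have := greedy_dim sa sb da db (exprn_gt0 n.+2 q0).
have -> : ln (q ^+ n.+2) / ln (B ^- n.+2) = g.
  rewrite lnXn // lnV ?posrE // lnXn // -lq lnV ?posrE //
    -[ln q *+ _]mulr_natl -[ln B *+ _]mulr_natl.
  by rewrite -mulrN invfM mulrACA divff ?pnatr_eq0 // mul1r.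
apply.
  rewrite -ler_pdivrMl // mulrC; apply: le_trans ha; rewrite ler_pdivlMr //.
  apply: le_trans hm1; rewrite -addn2 exprD.
  by rewrite le_eqVlt; apply/orP; left; apply/eqP; field; rewrite gt_eqF.
have := le_trans hb hm2; rewrite mulrC -ler_pdivlMr // => h.
rewrite mulrC -ler_pdivlMr //; apply: le_trans h _.
rewrite -[n.+2]addn2 (exprD q n 2).
by rewrite le_eqVlt; apply/orP; left; apply/eqP; field; rewrite !gt_eqF.
Qed.

End EssentialDims.

(** * The fixed points *)

Section FixedPoints.
Variables (K : realType) (R : nat).
Hypotheses (hR : (2 <= R)%N) (hRe : ~~ odd R).
Local Notation B := (R%:R : K).
Variables (p : nat -> K) (pstar : K).
Hypothesis adm : admissible R p pstar.
Local Notation p0 := (p 0%N).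
Variable mu : probability (measurableTypeR K) K.
Hypothesis ss : self_similar R p mu.

Let B0 : 0 < B := R_gt0 K hR.
Let p00 : 0 < p0 := p0_gt0 adm.
Local Notation N a b := (fine (mu `[a, b]%classic)).
Local Notation sumJ F := (\sum_(0 <= j < (R * (R - 1)).+1 | inJ K R j) F j).
Local Notation ball_mass x r := (N (x - r) (x + r)).
Local Notation D i r := (ball_mass (fixpt R i : K) r).

Lemma Smap_pre_fixpt i j : (j <= 2 * i * R)%N ->
  B * fixpt R i - j%:R / B = (2 * i * R - j)%:R / B.
Proof. by move=> h; rewrite /fixpt natrB // natrM; field; rewrite gt_eqF. Qed.

Lemma fixpt_mass i r :
  D i r = sumJ (fun j => p j * ball_mass (B * fixpt R i - j%:R / B) (B * r)).
Proof.
rewrite (mass_itv hR ss); apply: eq_bigr => j _; congr (_ * N _ _).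
  by rewrite mulrBr addrAC.
by rewrite mulrDr addrAC.
Qed.

Lemma tidx_pre i : B * fixpt R i - (tidx R i)%:R / B = fixpt R i.
Proof.
rewrite /tidx /fixpt !natrM natrB ?(ltnW hR) //; field.
by rewrite gt_eqF.
Qed.

Lemma fixpt_mass_ge i r : (i <= R./2)%N -> p (tidx R i) * D i (B * r) <= D i r.
Proof.
move=> hi; rewrite [leRHS]fixpt_mass -{1 2}(tidx_pre i).
apply: (sumJ_ge1 hR hRe (F := fun j => p j * ball_mass (B * fixpt R i - j%:R / B) (B * r))).
  by move=> j jJ; rewrite mulr_ge0 ?mass_ge0 // ltW // (pJ_gt0 adm).
exact: inJ_tidx.
Qed.

(** The closed image does not contain 2i/R; indices being integers, it misses it by at least R^-2,
    and the ball has radius at most that. *)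
Lemma far_piece_mass i j r : B * r <= B^-1 ->
  ((2 * i * R < j) || (j + R < 2 * i * R))%N ->
  ball_mass (B * fixpt R i - j%:R / B) (B * r) = 0.
Proof.
move=> hr; have E : B * fixpt R i = (2 * i * R)%:R / B.
  by rewrite /fixpt natrM; field; rewrite gt_eqF.
move=> /orP[h|h].
  apply: (itv_left hR hRe adm ss); rewrite E.
  have : (2 * i * R)%:R / B + B^-1 <= j%:R / B.
    by rewrite -[X in _ + X <= _]mul1r -mulrDl ler_pM2r ?invr_gt0 // natr1 ler_nat.
  by move: hr; lra.
apply: (itv_right hR hRe adm ss); rewrite E.
have : (j%:R + B + 1) / B <= (2 * i * R)%:R / B.
  by rewrite ler_pM2r ?invr_gt0 // -natrD natr1 ler_nat.
by rewrite !mulrDl mul1r divff ?gt_eqF //; move: hr; lra.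
Qed.

Lemma end_mass_le i r : i = 0%N \/ i = R./2 -> B * r <= B^-1 ->
  D i r <= p (tidx R i) * D i (B * r).
Proof.
move=> hi hr; have hi' : (i <= R./2)%N by case: hi => ->.
rewrite fixpt_mass (sumJ_only hR hRe (i := tidx R i)) ?tidx_pre ?inJ_tidx // => j jJ jt.
rewrite far_piece_mass ?mulr0 // -[X in is_true X]negbK negb_or -!leqNgt.
apply/negP => /andP[h1 h2].
have [jE|[i0 i1 _]] := inJ_near_fixpt hR hRe hi' jJ h2 h1; first by rewrite jE eqxx in jt.
by case: hi => hi; [rewrite hi in i0|rewrite hi ltnn in i1].
Qed.

(** Three images meet a small ball: that of t_i, which fixes the centre, and the two with an end
    point there, [b] and [c], which pull the centre back to 0 and to 1. *)
Lemma inner_mass_le i r : (0 < i < R./2)%N -> B * r <= B^-1 ->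
  D i r <= p (tidx R i) * D i (B * r) + (D 0%N (B * r) + D R./2 (B * r)).
Proof.
move=> /andP[i0 i1] hr; have hh := half_double hRe.
pose F j := p j * ball_mass (B * fixpt R i - j%:R / B) (B * r).
have F0 j : inJ K R j -> 0 <= F j.
  by move=> jJ; rewrite mulr_ge0 ?mass_ge0 // ltW // (pJ_gt0 adm).
have iR : (2 * i < R)%N by lia.
have iR' : (2 * i.-1 < R)%N by lia.
pose b := (2 * i * R)%N; pose c := (2 * i.-1 * R + R)%N.
have bE : (c + R = b)%N by rewrite /b /c; nia.
have tJ : inJ K R (tidx R i) by apply: inJ_tidx; exact: ltnW.
have bJ : inJ K R b by rewrite /b -[(2 * i * R)%N]addn0; apply: block_inJ.
have cJ : inJ K R c by apply: block_inJ.
have Fb : F b <= D 0%N (B * r).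
  rewrite /F Smap_pre_fixpt // subnn mul0r fixpt0 -[leRHS]mul1r.
  by rewrite ler_wpM2r ?mass_ge0 // (pJ_le1 hR hRe adm).
have Fc : F c <= D R./2 (B * r).
  rewrite /F Smap_pre_fixpt; last by rewrite -/b; lia.
  have -> : (2 * i * R - c = R)%N by rewrite -/b; lia.
  rewrite divff ?gt_eqF // (fixpt_half K hR hRe) -[leRHS]mul1r.
  by rewrite ler_wpM2r ?mass_ge0 // (pJ_le1 hR hRe adm).
rewrite fixpt_mass -/F.
apply: le_trans (_ : sumJ (fun j => (j == tidx R i)%:R * F (tidx R i) +
  ((j == b)%:R * F b + (j == c)%:R * F c)) <= _).
  apply: sumJ_le => j jJ.
  have nn k : inJ K R k -> 0 <= (j == k)%:R * F k.
    by move=> /F0 h; rewrite mulr_ge0 // ler0n.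
  have [jt|jt] := eqVneq j (tidx R i).
    by rewrite -jt mul1r lerDl addr_ge0 // nn.
  have [jb|jb] := eqVneq j b; first by rewrite -jb mul0r add0r mul1r lerDl nn.
  have [jc|jc] := eqVneq j c; first by rewrite -jc !mul0r !add0r mul1r.
  rewrite !mul0r !addr0 /F far_piece_mass ?mulr0 //.
  rewrite -[X in is_true X]negbK negb_or -!leqNgt; apply/negP => /andP[h1 h2].
  have [jE|[_ _ [jE|jE]]] := inJ_near_fixpt hR hRe (ltnW i1) jJ h2 h1.
  - by rewrite jE eqxx in jt.
  - by rewrite jE eqxx in jb.
  - by move/eqP: jc; apply; apply: (@addIn R); rewrite jE bE.
have one k : inJ K R k -> sumJ (fun j => (j == k)%:R * F k) = F k.
  move=> kJ; rewrite (sumJ_only hR hRe (i := k)) ?eqxx ?mul1r // => j _ /negbTE ->.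
  by rewrite mul0r.
rewrite !big_split /= !one //; apply: lerD; first by rewrite /F tidx_pre.
exact: lerD.
Qed.

Hypothesis inner_p : forall i, (0 < i < R./2)%N -> p0 < p (tidx R i).

Lemma fixpt_ball_ge i k : (i <= R./2)%N -> p (tidx R i) ^+ k <= D i (B ^- k).
Proof.
move=> hi; elim: k => [|k IH].
  rewrite !expr0 invr1 -[leLHS](itv01 hR hRe adm ss); apply: itv_homo.
    rewrite lerBlDr add0r -[leRHS](fixpt_half K hR hRe) /fixpt.
    by rewrite ler_pM2r ?invr_gt0 // ler_nat leq_mul2l hi.
  by rewrite lerDr /fixpt divr_ge0 // ltW.
apply: le_trans (fixpt_mass_ge _ hi); rewrite exprS.
have -> : B * B ^- k.+1 = B ^- k by rewrite exprS invfM mulVKf ?gt_eqF.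
by rewrite ler_pM2l // (adm_t_gt0 adm).
Qed.

Let BB k : B * (B ^- 2 * B ^- k.+1) = B ^- 2 * B ^- k.
Proof. by rewrite (exprS B k); field; rewrite !gt_eqF ?exprn_gt0. Qed.

Let BBle k : B ^- 2 * B ^- k <= B^-1.
Proof.
rewrite -invfM -exprD -[in leRHS](expr1 B); apply: invX_le => //.
Qed.

(** The starting radius R^-2 makes [B * r <= B^-1] hold at each step of the recursion. *)
Lemma end_ball_le i k : i = 0%N \/ i = R./2 ->
  D i (B ^- 2 * B ^- k) <= p (tidx R i) ^+ k.
Proof.
move=> hi; elim: k => [|k IH]; first by rewrite expr0 mass_le1.
have := @end_mass_le i (B ^- 2 * B ^- k.+1) hi; rewrite BB => /(_ (BBle k)) h.
apply: le_trans h _; rewrite [leRHS]exprS ler_pM2l // (adm_t_gt0 adm) //.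
by case: hi => ->.
Qed.

(* The ends contribute at the slower rate [p0], which is absorbed by adding
   [ca] times their mass. *)
Lemma inner_ball_le i k : (0 < i < R./2)%N ->
  D i (B ^- 2 * B ^- k) <= (1 + 2 / (p (tidx R i) - p0)) * p (tidx R i) ^+ k.
Proof.
move=> hi; have hp := inner_p hi; set pt := p (tidx R i) in hp *.
have pt0 : 0 < pt by exact: lt_trans hp.
pose ca := (pt - p0)^-1.
have ca0 : 0 < ca by rewrite invr_gt0 subr_gt0.
(* With this identity the recursion multiplies [D + ca * E] by at most [pt]. *)
have caE : ca * pt = 1 + ca * p0.
  by apply/eqP; rewrite -subr_eq -mulrBr mulVf // subr_eq0 gt_eqF.
pose E k := D 0%N (B ^- 2 * B ^- k) + D R./2 (B ^- 2 * B ^- k).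
have E0 j : 0 <= E j by rewrite addr_ge0 ?mass_ge0.
suff H : D i (B ^- 2 * B ^- k) + ca * E k <= (1 + 2 * ca) * pt ^+ k.
  by apply: le_trans H; rewrite lerDl mulr_ge0 // ltW.
have ES j : E j.+1 <= p0 * E j.
  have h0 := @end_mass_le 0%N (B ^- 2 * B ^- j.+1) (or_introl erefl).
  have h1 := @end_mass_le R./2 (B ^- 2 * B ^- j.+1) (or_intror erefl).
  rewrite BB tidx0 in h0; rewrite BB (tidx_half hRe) -(adm_ends adm) in h1.
  by rewrite /E mulrDr lerD ?h0 ?h1 ?BBle.
elim: k => [|k IH].
  rewrite !expr0 !invr1 !mulr1 /E lerD ?mass_le1 // mulrC ler_pM2r //.
  by rewrite (natrD K 1 1) lerD ?mass_le1.
have := @inner_mass_le i (B ^- 2 * B ^- k.+1) hi; rewrite BB => /(_ (BBle k)) h.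
have {}h : D i (B ^- 2 * B ^- k.+1) <= pt * D i (B ^- 2 * B ^- k) + E k by [].
apply: le_trans (_ : pt * (D i (B ^- 2 * B ^- k) + ca * E k) <= _).
  set X := D i (B ^- 2 * B ^- k) in h *.
  have -> : pt * (X + ca * E k) = pt * X + ca * pt * E k by ring.
  rewrite caE mulrDl mul1r addrA.
  by apply: lerD => //; rewrite -mulrA ler_pM2l.
by rewrite [pt ^+ _]exprS mulrCA ler_pM2l.
Qed.

Lemma fixpt_pos i r : (i <= R./2)%N -> 0 < r -> 0 < D i r.
Proof.
move=> hi r0; have [k hk] := invX_small hR r0.
apply: lt_le_trans (ball_mass_homo mu _ (ltW hk)).
by apply: lt_le_trans (fixpt_ball_ge k hi); rewrite exprn_gt0 // (adm_t_gt0 adm).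
Qed.

Lemma fixpt_dim i : (i <= R./2)%N ->
  has_local_dim mu (fixpt R i) (ln (p (tidx R i)) / ln (B^-1)).
Proof.
move=> hi; have pt0 := adm_t_gt0 adm hi.
have [C C0 hC] : exists2 C, 0 < C &
    forall k, D i (B ^- 2 * B ^- k) <= C * p (tidx R i) ^+ k.
  have [i0|i0] := posnP i.
    by exists 1 => // k; rewrite mul1r; apply: end_ball_le; left.
  have [i1|i1] := eqVneq i R./2.
    by exists 1 => // k; rewrite mul1r; apply: end_ball_le; right.
  have hi' : (0 < i < R./2)%N by rewrite i0 ltn_neqAle i1.
  exists (1 + 2 / (p (tidx R i) - p0)); last by move=> k; exact: inner_ball_le.
  by rewrite addr_gt0 // divr_gt0 // subr_gt0 inner_p.
apply: (@geometric_ln_ratio _ (fun r => D i r) _ (B^-1) _ 1 (B ^- 2) 1 C) => //.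
- by move=> r r'; exact: ball_mass_homo.
- exact: invB_itv.
- by rewrite invr_gt0 exprn_gt0.
- by move=> k; rewrite !mul1r exprVn; exact: fixpt_ball_ge.
- by move=> k; rewrite exprVn; exact: hC.
Qed.

End FixedPoints.

(** * The choice of probabilities *)

Section Weights.
Variables (K : realType) (R : nat).
Hypotheses (hR : (2 <= R)%N) (hRe : ~~ odd R).

Lemma tidx_notI i : (i <= R./2)%N -> ~~ inI K R (tidx R i).
Proof.
move=> hi; have hh := half_double hRe; apply/negP => /(inIP K hR)[/andP[h1 h2] H].
have [i0|i0] := posnP i; first by rewrite i0 tidx0 in h1.
have [iE|ih] := eqVneq i R./2.
  by move: h2; rewrite iE (tidx_half hRe) leqNgt ltn_subrL muln_gt0; lia.
have := H i hi; rewrite tidx_eq; apply.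
have : (2 * i <= 2 * i * R)%N by apply: leq_pmulr; lia.
by move: ih; rewrite neq_ltn => /orP[]; lia.
Qed.

(** The quotient recovers i from t_i = 2i(R - 1). The last t_i is treated apart, as its weight must
    equal that of t_0. *)
Definition weight (j : nat) : nat :=
  if inI K R j then (2 * R)%N else if j == (R * (R - 1))%N then R
  else (R + j %/ (2 * (R - 1)))%N.

Lemma weight_inner i : (i < R./2)%N -> weight (tidx R i) = (R + i)%N.
Proof.
move=> hi; have hh := half_double hRe.
rewrite /weight (negbTE (tidx_notI (ltnW hi))).
rewrite /tidx eqn_pmul2r ?subn_gt0 //; case: eqVneq => [E|_]; first by lia.
by rewrite mulnAC mulKn //; lia.
Qed.

Lemma weight_end : weight (R * (R - 1)) = R.
Proof.
by rewrite /weight -(tidx_half hRe) (negbTE (tidx_notI (leqnn _))) eqxx.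
Qed.

Lemma weight_I j : inI K R j -> weight j = (2 * R)%N.
Proof. by rewrite /weight => ->. Qed.

Lemma weight0 : weight 0 = R.
Proof. by rewrite -(tidx0 R) weight_inner ?addn0 //; lia. Qed.

Lemma weight_ge j : inJ K R j -> (R <= weight j)%N.
Proof.
move=> /inJP[/weight_I ->|[i hi ->]]; first by lia.
have [->|ih] := eqVneq i R./2; first by rewrite (tidx_half hRe) weight_end.
by rewrite weight_inner ?leq_addr // ltn_neqAle ih.
Qed.

Definition total_weight : nat :=
  \sum_(0 <= j < (R * (R - 1)).+1 | inJ K R j) weight j.

Lemma total_weight_gt0 : (0 < total_weight)%N.
Proof.
have h0 : inJ K R 0 by rewrite -(tidx0 R) inJ_tidx.
rewrite /total_weight big_mkord (bigD1 ord0) //= weight0.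
by rewrite addn_gt0 (ltnW hR).
Qed.

Definition prob (j : nat) : K := (weight j)%:R / total_weight%:R.

Lemma prob_le j k : (prob j <= prob k) = (weight j <= weight k)%N.
Proof. by rewrite /prob ler_pM2r ?invr_gt0 ?ltr0n ?total_weight_gt0 // ler_nat. Qed.

Lemma prob_lt j k : (prob j < prob k) = (weight j < weight k)%N.
Proof. by rewrite /prob ltr_pM2r ?invr_gt0 ?ltr0n ?total_weight_gt0 // ltr_nat. Qed.

Lemma prob_gt0 j : (0 < weight j)%N -> 0 < prob j.
Proof. by move=> h; rewrite divr_gt0 // ltr0n // total_weight_gt0. Qed.

Definition prob_star : K := (2 * R)%:R / total_weight%:R.

Lemma prob_admissible : admissible R prob prob_star.
Proof.
have R0 := ltnW hR.
split.
- by move=> i hi; apply: prob_gt0; apply: leq_trans (weight_ge (inJ_tidx K hi)).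
- by rewrite divr_gt0 // ltr0n ?total_weight_gt0 // muln_gt0.
- by move=> j /weight_I E; rewrite /prob E.
- rewrite /prob -mulr_suml -natr_sum divff // pnatr_eq0 -lt0n.
  exact: total_weight_gt0.
- by rewrite /prob weight0 weight_end.
- by move=> j jJ; rewrite prob_le weight0 weight_ge.
Qed.

Lemma prob_star_le : prob_star <= 2 * prob 0%N.
Proof. by rewrite /prob_star /prob weight0 natrM mulrA. Qed.

Lemma prob_inner i : (0 < i < R./2)%N -> prob 0%N < prob (tidx R i).
Proof. by move=> /andP[i0 i1]; rewrite prob_lt weight0 weight_inner //; lia. Qed.

Lemma prob_lt_star i : (i <= R./2)%N -> prob (tidx R i) < prob_star.
Proof.
move=> hi; rewrite /prob_star /prob ltr_pM2r ?invr_gt0 ?ltr0n ?total_weight_gt0 //.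
rewrite ltr_nat; have hh := half_double hRe.
have [->|ih] := eqVneq i R./2; first by rewrite (tidx_half hRe) weight_end; lia.
have ih' : (i < R./2)%N by rewrite ltn_neqAle ih.
by rewrite weight_inner //; lia.
Qed.

Lemma prob_inj i j : (i < R./2)%N -> (j < R./2)%N ->
  prob (tidx R i) = prob (tidx R j) -> i = j.
Proof.
move=> hi hj E; apply: (@addnI R); rewrite -!weight_inner //.
by apply/eqP; rewrite eqn_leq -!prob_le E lexx.
Qed.

End Weights.

Theorem theorem4p3 (K : realType) (R : nat) (hR2 : (2 <= R)%N)
    (hReven : ~~ odd R) :
  exists (p : nat -> K) (pstar : K), admissible R p pstar /\
  forall mu : probability (measurableTypeR K) K, self_similar R p mu ->
    let attainable := local_dims mu (supp mu) in
    let ess := local_dims mu (supp mu `&` in_essential_class R) in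
    let dim i := ln (p (tidx R i)) / ln (R%:R^-1) in
    [/\ attainable = ess `|` [set dim i | i in [set i | (i <= R./2)%N]],
        ess !=set0 /\ is_interval ess,
        forall i, (i <= R./2)%N -> ~ ess (dim i),
        forall i j, (i < R./2)%N -> (j < R./2)%N -> dim i = dim j -> i = j &
        p (tidx R 0) = p (tidx R R./2)].
Proof.
have adm := prob_admissible K hR2 hReven.
exists (prob K R), (prob_star K R); split => // mu ss attainable ess dim.
have star := prob_star_le K hR2 hReven.
have B1 := R_gt1 K hR2; have lB : ln (R%:R^-1 : K) < 0.
  by rewrite ln_lt0 // invr_gt0 (R_gt0 K hR2) invf_lt1 // (R_gt0 K hR2).
have pt0 i : (i <= R./2)%N -> 0 < prob K R (tidx R i) by exact: (adm_t_gt0 adm).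
have hdim i : (i <= R./2)%N -> has_local_dim mu (fixpt R i) (dim i).
  by move=> hi; apply: (fixpt_dim hR2 hReven adm ss) => // j; exact: prob_inner.
split.
- apply/seteqP; split => d.
    move=> [x sx hd].
    (* At a fixed point, uniqueness of limits identifies the dimension; every other point of the
       support is in the essential class. *)
    have [[i hi xi]|H] := pselect (exists2 i, (i <= R./2)%N & x = fixpt R i).
      right; exists i => //; rewrite xi in hd.
      exact: (cvg_unique _ (hdim i hi) hd).
    left; exists x => //; split => //.
    apply: essential_point => //; first exact: (supp_itv hR2 hReven adm ss).
    by move=> i hi xi; apply: H; exists i.
  move=> [[x [sx _] hd]|[i hi <-]]; first by exists x.
  exists (fixpt R i); last exact: hdim.
  apply: supp_ball_mass => r r0; exact: (fixpt_pos hR2 hReven adm ss).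
- split; first exact: (ess_nonempty hR2 hReven adm ss star).
  exact: (ess_interval hR2 hReven adm ss star).
- move=> i hi /(ess_le hR2 hReven adm ss star).
  (* Division by the negative ln (1/R) turns p_(t_i) < p* into a dimension above the upper bound of
     [ess_le]. *)
  rewrite leNgt /dim ltr_nM2r ?invr_lt0 // ltr_ln ?posrE ?pt0 ?(adm_star_gt0 adm) //.
  by rewrite prob_lt_star.
- move=> i j hi hj; rewrite /dim => /(mulIf (invr_neq0 (ltr0_neq0 lB))) E.
  apply: (prob_inj hR2 hReven hi hj).
  by apply: ln_inj E; rewrite posrE pt0 // ltnW.
- by rewrite tidx0 (tidx_half hReven) (adm_ends adm).
Qed.
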